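(* Let $\mathfrak{c}$ be the cardinality of the continuum. The Banach lattice $\ell_1(\mathfrak{c},L_1([0,1]^{\mathfrak{c}}))$ is of universal disposition for the class of separable Banach lattices of the form $L_1(\nu)$.
   Context: Banach lattices are real. An embedding is an isometric lattice embedding: a linear, norm-preserving map commuting with the lattice operations. For a class $\mathcal{C}$ of Banach lattices, a Banach lattice $X$ is of universal disposition for $\mathcal{C}$ if for all embeddings $f:R\to S$ and $g:R\to X$ of Banach lattices with $S\in\mathcal{C}$, there exists an embedding $h:S\to X$ with $h\circ f=g$. The product $[0,1]^{\mathfrak{c}}$ carries the product of Lebesgue measures. For a cardinal $\tau$ and a Banach lattice $X$, $\ell_1(\tau,X)$ is the $\ell_1$-sum of $\tau$ many copies of $X$, with coordinatewise order. A Banach lattice is of the form $L_1(\nu)$ if it is lattice isometric to $L_1(\nu)$ for some positive measure $\nu$. *)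

(* Defs.v *)
From HB Require Import structures.
From mathcomp Require Import all_boot all_order all_algebra.
From mathcomp Require Import finmap.
From mathcomp Require Import ring lra.
From mathcomp Require Import all_classical all_reals all_analysis measurable_realfun.

Set Implicit Arguments.
Unset Strict Implicit.
Unset Printing Implicit Defensive.

Import Order.TTheory GRing.Theory Num.Theory.
Import numFieldNormedType.Exports.

Local Open Scope classical_set_scope.
Local Open Scope ring_scope.

(* The order and lattice operations are fields of the mixin, not inherited from
   Order.Lattice: a join of Order.POrder with the normed structures that does
   not inherit from Num.NumDomain cannot be added to the closed hierarchy. *)
HB.mixin Record isBanachLattice (R : realType) V
  & CompleteNormedModule R V := {
  vle : V -> V -> Prop ;
  vjoin : V -> V -> V ;
  vmeet : V -> V -> V ;
  vle_refl : forall x, vle x x ;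
  vle_anti : forall x y, vle x y -> vle y x -> x = y ;
  vle_trans : forall y x z, vle x y -> vle y z -> vle x z ;
  vjoinP : forall x y z, vle (vjoin x y) z <-> vle x z /\ vle y z ;
  vmeetP : forall x y z, vle z (vmeet x y) <-> vle z x /\ vle z y ;
  vleD2r : forall z x y, vle x y -> vle (x + z) (y + z) ;
  vscale_ge0 : forall (a : R) x, 0 <= a -> vle 0 x -> vle 0 (a *: x) ;
  vnorm_mono : forall x y,
    vle (vjoin x (- x)) (vjoin y (- y)) -> `|x| <= `|y|
}.

#[short(type="banachLatticeType")]
HB.structure Definition BanachLattice (R : realType) :=
  { V of isBanachLattice R V & CompleteNormedModule R V }.

Arguments vle_trans {R s} [y x z].
Arguments vle_anti {R s} [x y].
Arguments vleD2r {R s} z [x y].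
Arguments vscale_ge0 {R s} [a x].
Arguments vnorm_mono {R s} [x y].

Record is_embedding (R : realType) (X Y : banachLatticeType R) (f : X -> Y) :
    Prop := IsEmbedding {
  embedding_linear : linear f ;
  embedding_norm : forall x, `|f x| = `|x| ;
  embedding_join : {morph f : x y / vjoin x y} ;
  embedding_meet : {morph f : x y / vmeet x y}
}.

Definition lattice_isometric (R : realType) (X Y : banachLatticeType R) :=
  exists2 f : X -> Y, is_embedding f & (forall y, exists x, f x = y).

Definition universal_disposition (R : realType)
    (C : banachLatticeType R -> Prop) (X : banachLatticeType R) :=
  forall (E S : banachLatticeType R) (f : E -> S) (g : E -> X),
    C S -> is_embedding f -> is_embedding g ->
    exists2 h : S -> X, is_embedding h & h \o f =1 g.

Lemma fast_cauchy_complete (R : realType) (V : normedModType R) :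
  (forall u : nat -> V, (forall n, `|u n.+1 - u n| <= 2^-1 ^+ n) -> cvgn u) ->
  forall F : set_system V, ProperFilter F -> cauchy F -> cvg F.
Proof.
move=> H F FF Fc.
have e0 n : 0 < 2^-1 ^+ n / 2 / 2 :> R by rewrite !divr_gt0 ?exprn_gt0.
have Fc1 : cauchy_ex F by apply/cauchyP.
have /choice[u uP] : forall n, exists x : V, F (ball x (2^-1 ^+ n / 2 / 2)).
  by move=> n; exact: Fc1.
have /H /cvg_ex[l ul] : forall n, `|u n.+1 - u n| <= 2^-1 ^+ n.
  move=> n; have [y []] := filter_ex (@filterI _ F _ _ _ (uP n) (uP n.+1)).
  rewrite -!ball_normE /= => h1.
  rewrite exprS => h2; move: (e0 n) h1 h2; set e := 2^-1 ^+ n => e_gt0 h1 h2.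
  rewrite -[u n.+1](subrK y) -addrA (le_trans (ler_normD _ _))//.
  have := distrC y (u n); lra.
apply/cvg_ex; exists l; apply/cvg_ballP => e e_gt0.
have h2 : (fun n => 2^-1 ^+ n : R) @ \oo --> 0.
  by apply: cvg_expr; rewrite ger0_norm// invf_lt1// ltr1n.
have e20 : 0 < e / 2 by rewrite divr_gt0.
near \oo => n.
have h3 : `|l - u n| < e / 2.
  by near: n; move/cvgrPdist_lt : ul; exact.
have h4 : 2^-1 ^+ n < e / 2.
  near: n; move/cvgrPdist_lt : h2 => /(_ _ e20).
  by apply: filterS => k; rewrite sub0r normrN ger0_norm// exprn_ge0.
apply: filterS (uP n) => y; rewrite -!ball_normE /= => h5.
rewrite -[l](subrK (u n)) -addrA (le_lt_trans (ler_normD _ _))//.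
move: (e0 n) h3 h4 h5; set c := 2^-1 ^+ n => *; lra.
Unshelve. all: by end_near. Qed.

Lemma geometric_half_le2 (R : realType) n :
  \sum_(k < n) 2^-1 ^+ k <= 2 :> R.
Proof.
suff -> : \sum_(k < n) 2^-1 ^+ k = 2 - 2 * 2^-1 ^+ n :> R.
  by rewrite lerBlDr lerDl mulr_ge0// exprn_ge0.
elim: n => [|n ih]; first by rewrite big_ord0 expr0; lra.
rewrite big_ord_recr /= ih exprS; lra.
Qed.

Section fast_cauchy.
Context (R : realType).

Lemma fast_tail (V : normedModType R) (u : nat -> V) :
  (forall n, `|u n.+1 - u n| <= 2^-1 ^+ n) ->
  forall n m, (n <= m)%N -> `|u m - u n| <= 2 * 2^-1 ^+ n.
Proof.
move=> u_fast n m /subnK <-; move: (m - n)%N => k.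
apply: (@le_trans _ _ (2 * 2^-1 ^+ n - 2 * 2^-1 ^+ (k + n))); last first.
  by rewrite lerBlDr lerDl mulr_ge0// exprn_ge0.
elim: k => [|k ih]; first by rewrite add0n !subrr normr0.
rewrite addSn -[u _.+1](subrK (u (k + n)%N)) -addrA.
rewrite (le_trans (ler_normD _ _))//.
have := u_fast (k + n)%N; rewrite exprS; lra.
Qed.

Lemma fast_cvg (V : completeNormedModType R) (u : nat -> V) :
  (forall n, `|u n.+1 - u n| <= 2^-1 ^+ n) -> cvgn u.
Proof.
move=> u_fast; have -> : u = (fun n => u 0%N + series (telescope u) n).
  by apply/funext => n; exact: eq_sum_telescope.
apply: is_cvgD; first exact: is_cvg_cst.
apply: normed_cvg; apply: nondecreasing_is_cvgn.
  by apply: nondecreasing_series => n _ _ /=.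
exists 2 => _ [n _ <-].
rewrite -[X in X <= _]/(\sum_(0 <= k < n) `|telescope u k|) big_mkord.
apply: le_trans (geometric_half_le2 R n).
by apply: ler_sum => k _; exact: u_fast.
Qed.

End fast_cauchy.

Section vabs_theory.
Context (R : realType) (X : banachLatticeType R).
Implicit Types x y : X.

Definition vabs x := vjoin x (- x).

Lemma vle_joinl x y : vle x (vjoin x y).
Proof. by have [] := (vjoinP x y _).1 (vle_refl _). Qed.
Lemma vle_joinr x y : vle y (vjoin x y).
Proof. by have [] := (vjoinP x y _).1 (vle_refl _). Qed.
Lemma vle_meetl x y : vle (vmeet x y) x.
Proof. by have [] := (vmeetP x y _).1 (vle_refl _). Qed.
Lemma vle_meetr x y : vle (vmeet x y) y.
Proof. by have [] := (vmeetP x y _).1 (vle_refl _). Qed.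

Lemma vleD (a b c d : X) : vle a b -> vle c d -> vle (a + c) (b + d).
Proof.
move=> ab cd; apply: (vle_trans (vleD2r c ab)).
by rewrite ![b + _]addrC; exact: vleD2r.
Qed.

Lemma vleN x y : vle x y -> vle (- y) (- x).
Proof.
by move=> /(vleD2r (- x - y)); rewrite addrA subrr sub0r addrCA subrr addr0.
Qed.

Lemma vabs_ge0 x : vle 0 (vabs x).
Proof.
have := vleD (vle_joinl x (- x)) (vle_joinr x (- x)); rewrite subrr.
have h2 : 0 <= 2^-1 :> R by rewrite invr_ge0.
move=> /(vscale_ge0 h2); rewrite scalerDr -scalerDl.
have -> : 2^-1 + 2^-1 = 1 :> R by lra.
by rewrite scale1r.
Qed.

Lemma norm_vabs_le x : `|vabs x| <= `|x|.
Proof.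
apply: vnorm_mono; apply/vjoinP; split; first exact: vle_refl.
apply: (@vle_trans _ _ 0); last exact: vabs_ge0.
by rewrite -[X in vle _ X]oppr0; apply: vleN; exact: vabs_ge0.
Qed.

Lemma norm_vle_bound x y z :
  vle x (vabs y + vabs z) -> vle (- x) (vabs y + vabs z) ->
  `|x| <= `|y| + `|z|.
Proof.
move=> h1 h2; apply: le_trans (lerD (norm_vabs_le y) (norm_vabs_le z)).
apply: le_trans (ler_normD _ _); apply: vnorm_mono.
by apply: (vle_trans _ (vle_joinl _ _)); apply/vjoinP.
Qed.

Let leDl y z : vle (vabs y) (vabs y + vabs z).
Proof.
by have := vleD (vle_refl (vabs y)) (vabs_ge0 z); rewrite addr0.
Qed.
Let leDr y z : vle (vabs z) (vabs y + vabs z).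
Proof. by rewrite addrC; exact: leDl. Qed.

Lemma norm_vjoin x y : `|vjoin x y| <= `|x| + `|y|.
Proof.
apply: norm_vle_bound.
  by apply/vjoinP; split; [apply: vle_trans (leDl x y)|apply: vle_trans (leDr x y)];
    exact: vle_joinl.
apply: vle_trans (leDl x y); apply: vle_trans (vle_joinr _ _).
by apply: vleN; exact: vle_joinl.
Qed.

Lemma norm_vmeet x y : `|vmeet x y| <= `|x| + `|y|.
Proof.
apply: norm_vle_bound.
  by apply: vle_trans (leDl x y); apply: (vle_trans (vle_meetl x y));
    exact: vle_joinl.
rewrite -[X in vle _ X]opprK; apply: vleN; apply/vmeetP; split.
  rewrite -[X in vle _ X]opprK; apply: vleN.
  by apply: vle_trans (leDl x y); exact: vle_joinr.
rewrite -[X in vle _ X]opprK; apply: vleN.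
by apply: vle_trans (leDr x y); exact: vle_joinr.
Qed.

End vabs_theory.

Section L1.
Context d (T : measurableType d) (R : realType).
Variable mu : {measure set T -> \bar R}.

(* The library has the carrier of L_1 (classes of measurable functions modulo
   almost everywhere equality, with finite 1-norm), but no vector space
   structure, norm, order or completeness on it. *)
Definition L1 : Type := LspaceType1 mu.
Local Notation LF := (LfunType mu (@lexx _ _ 1%E)).

Lemma LF_measurable (f : LF) :
  @measurable_fun _ _ T (measurableTypeR R) setT (f : T -> R).
Proof. exact: (@measurable_funPT _ _ T R f). Qed.

Definition LF_mfun (f : LF) : {mfun T >-> measurableTypeR R} :=
  HB.pack (f : T -> measurableTypeR R)
    (@isMeasurableFun.Build _ _ T (measurableTypeR R) f (LF_measurable f)).

Definition L1_pi (f : LF) : {mfun_ mu, T >-> measurableTypeR R} :=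
  (\pi_({mfun_ mu, T >-> measurableTypeR R}) (LF_mfun f))%qT.

Lemma L1_piE (f : LF) : repr (L1_pi f) = f %[ae mu].
Proof.
suff /eqquotP/asboolP : (repr (L1_pi f) = LF_mfun f
  %[mod {mfun_ mu, T >-> measurableTypeR R}])%qT by [].
by rewrite reprK.
Qed.

Lemma Lnorm1_ae_eq (f g : T -> R) : measurable_fun setT f ->
  measurable_fun setT g -> f = g %[ae mu] ->
  ('N[mu]_1[EFin \o f] = 'N[mu]_1[EFin \o g])%E.
Proof.
move=> mf mg fg; rewrite !Lnorm1; apply: ae_eq_integral => //.
- exact/measurable_EFinP/measurableT_comp.
- exact/measurable_EFinP/measurableT_comp.
- by apply: filterS fg => t /= /(_ I) ->.
Qed.

Lemma L1_pi_finite (f : LF) : finite_norm mu 1 (L1_pi f).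
Proof.
rewrite /finite_norm (Lnorm1_ae_eq _ _ (L1_piE f)).
- exact: Lfunction_finite.
- exact: (@measurable_funPT _ _ T (measurableTypeR R) (repr (L1_pi f))).
- exact: LF_measurable.
Qed.

Definition toL1 (f : LF) : L1 :=
  @LebesgueSpace.Pack d T R mu _ _ (L1_pi f)
   (LebesgueSpace.Class
     (isFinLebesgue.Build d T R mu _ (@lexx _ _ 1%E) (L1_pi f) (L1_pi_finite f))).

Lemma L1_fun_in (x : L1) : (x : T -> R) \in Lfun mu 1.
Proof.
apply/andP; split; rewrite inE/=; last exact: Lebesgue_finite.
exact: (@measurable_funPT _ _ T (measurableTypeR R) (repr (LebesgueSpace.sort x))).
Qed.

Definition L1_fun (x : L1) : LF := Lfun_Sub _ (L1_fun_in x).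

Lemma toL1K (f : LF) : L1_fun (toL1 f) = f %[ae mu].
Proof. exact: L1_piE. Qed.

Lemma toL1_eqP (f g : LF) : toL1 f = toL1 g <-> f = g %[ae mu].
Proof.
split=> [fg|fg].
  have h := toL1K f; rewrite fg in h.
  exact: (ae_eq_trans (ae_eq_sym h) (toL1K g)).
have e : L1_pi f = L1_pi g by apply/eqquotP/asboolP.
rewrite /toL1; move: (L1_pi_finite f) (L1_pi_finite g); rewrite e => p q.
by have -> : p = q by exact: Prop_irrelevance.
Qed.

Lemma L1_funK (x : L1) : toL1 (L1_fun x) = x.
Proof.
have e : L1_pi (L1_fun x) = LebesgueSpace.sort x.
  rewrite -[RHS]reprK; apply/eqquotP/asboolP.
  by apply: filterE => t.
case: x e => x [[p]] /= e.
rewrite /toL1; move: (L1_pi_finite _); rewrite e => q.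
by have -> : p = q by exact: Prop_irrelevance.
Qed.

Lemma L1P (x : L1) : exists f, x = toL1 f.
Proof. by exists (L1_fun x); rewrite L1_funK. Qed.

Lemma LF_max_in (f g : LF) : (fun t => Num.max (f t) (g t)) \in Lfun mu 1.
Proof.
have h := LfunP (2^-1 *: (f + g + Lfun_Sub _ (Lfun_norm (LfunP (f - g))))).
by under eq_fun do rewrite maxr_absE mulrC.
Qed.

Lemma LF_min_in (f g : LF) : (fun t => Num.min (f t) (g t)) \in Lfun mu 1.
Proof.
have h := LfunP (2^-1 *: (f + g - Lfun_Sub _ (Lfun_norm (LfunP (f - g))))).
by under eq_fun do rewrite minr_absE mulrC.
Qed.

Definition LF_max (f g : LF) : LF := Lfun_Sub _ (LF_max_in f g).
Definition LF_min (f g : LF) : LF := Lfun_Sub _ (LF_min_in f g).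

HB.instance Definition _ := gen_eqMixin L1.
HB.instance Definition _ := gen_choiceMixin L1.

Let L1_0 : L1 := toL1 0.
Let L1_opp (x : L1) : L1 := toL1 (- L1_fun x).
Let L1_add (x y : L1) : L1 := toL1 (L1_fun x + L1_fun y).
Let L1_scale (a : R) (x : L1) : L1 := toL1 (a *: L1_fun x).

Lemma toL1_subN f : toL1 (- f) = L1_opp (toL1 f).
Proof.
apply/esym/toL1_eqP; apply: filterS (toL1K f) => t /(_ I) e _.
exact: (congr1 -%R e).
Qed.

Lemma toL1_subD f g : toL1 (f + g) = L1_add (toL1 f) (toL1 g).
Proof.
apply/esym/toL1_eqP; apply: filterS2 (toL1K f) (toL1K g).
move=> t /(_ I) ef /(_ I) eg _; exact: (congr2 +%R ef eg).
Qed.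

Lemma toL1_subZ a f : toL1 (a *: f) = L1_scale a (toL1 f).
Proof.
apply/esym/toL1_eqP; apply: filterS (toL1K f) => t /(_ I) e _.
exact: (congr1 ( *%R a) e).
Qed.

Let L1_addA : associative L1_add.
Proof.
move=> x y z; have [[[f ->] [g ->]] [h ->]] := (L1P x, L1P y, L1P z).
by rewrite -!toL1_subD addrA.
Qed.
Let L1_addC : commutative L1_add.
Proof.
by move=> x y; have [[f ->] [g ->]] := (L1P x, L1P y); rewrite -!toL1_subD addrC.
Qed.
Let L1_add0 : left_id L1_0 L1_add.
Proof. by move=> x; have [f ->] := L1P x; rewrite -toL1_subD add0r. Qed.
Let L1_addN : left_inverse L1_0 L1_opp L1_add.
Proof.
by move=> x; have [f ->] := L1P x; rewrite -toL1_subN -toL1_subD addNr.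
Qed.

HB.instance Definition _ := GRing.isZmodule.Build L1
  L1_addA L1_addC L1_add0 L1_addN.

Let L1_scaleA a b x : L1_scale a (L1_scale b x) = L1_scale (a * b) x.
Proof. by have [f ->] := L1P x; rewrite -!toL1_subZ scalerA. Qed.
Let L1_scale1 : left_id 1 L1_scale.
Proof. by move=> x; have [f ->] := L1P x; rewrite -toL1_subZ scale1r. Qed.
Let L1_scaleDr : right_distributive L1_scale +%R.
Proof.
move=> a x y; have [[f ->] [g ->]] := (L1P x, L1P y).
by rewrite /GRing.add /= -!(toL1_subZ, toL1_subD) scalerDr.
Qed.
Let L1_scaleDl x : {morph L1_scale^~ x : a b / a + b}.
Proof.
move=> a b; have [f ->] := L1P x.
by rewrite -!toL1_subZ [RHS]/GRing.add /= -toL1_subD scalerDl.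
Qed.

HB.instance Definition _ := GRing.Zmodule_isLmodule.Build R L1
  L1_scaleA L1_scale1 L1_scaleDr L1_scaleDl.

Lemma toL1D f g : toL1 (f + g) = toL1 f + toL1 g. Proof. exact: toL1_subD. Qed.
Lemma toL1N f : toL1 (- f) = - toL1 f. Proof. exact: toL1_subN. Qed.
Lemma toL1B f g : toL1 (f - g) = toL1 f - toL1 g.
Proof. by rewrite toL1D toL1N. Qed.
Lemma toL1Z a f : toL1 (a *: f) = a *: toL1 f. Proof. exact: toL1_subZ. Qed.

Definition L1_norm (x : L1) : R := fine ('N[mu]_1[EFin \o L1_fun x])%E.

Lemma L1_norm_toL1 f : L1_norm (toL1 f) = fine ('N[mu]_1[EFin \o f])%E.
Proof.
congr fine; apply: Lnorm1_ae_eq; last exact: toL1K.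
- exact: (LF_measurable (L1_fun (toL1 f))).
- exact: LF_measurable.
Qed.

Let L1_normD x y : L1_norm (x + y) <= L1_norm x + L1_norm y.
Proof.
have [[f ->] [g ->]] := (L1P x, L1P y).
by rewrite -toL1D !L1_norm_toL1 ler_LnormD.
Qed.
Let L1_normZ a x : L1_norm (a *: x) = `|a| * L1_norm x.
Proof.
have [f ->] := L1P x.
by rewrite -toL1Z !L1_norm_toL1 LnormZ -finite_norm_fine -EFinM.
Qed.
Let L1_norm0 x : L1_norm x = 0 -> x = 0.
Proof.
have [f ->] := L1P x.
by rewrite L1_norm_toL1 => /fine_Lnormr_eq0 f0; apply/toL1_eqP.
Qed.

HB.instance Definition _ := Lmodule_isNormed.Build R L1
  L1_normD L1_normZ L1_norm0.

Lemma normL1E f : (`|toL1 f|%:E = \int[mu]_t `|f t|%:E)%E.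
Proof.
by rewrite -[X in X%:E]/(L1_norm (toL1 f)) L1_norm_toL1 finite_norm_fine Lnorm1.
Qed.

Section L1_complete.
Variable u : nat -> L1.
Hypothesis u_fast : forall n, `|u n.+1 - u n| <= 2^-1 ^+ n.

Let f n := L1_fun (u n).
Let h n t := (`|f n.+1 t - f n t|%:E)%E.
Let G t := (\sum_(n <oo) h n t)%E.

Let mf n : measurable_fun setT (f n : T -> R).
Proof. exact: LF_measurable. Qed.

Let mh n : measurable_fun setT (h n).
Proof.
by apply/measurable_EFinP/measurableT_comp => //; exact: measurable_funB.
Qed.

Let h_ge0 n t : (0 <= h n t)%E. Proof. by rewrite lee_fin. Qed.

Let mG : measurable_fun setT G.
Proof. by apply: ge0_emeasurable_sum => // n t _ _; exact: h_ge0. Qed.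

Let iG : mu.-integrable setT G.
Proof.
apply/integrableP; split => //.
under eq_integral do rewrite gee0_abs ?nneseries_ge0//.
rewrite integral_nneseries//.
apply: (@le_lt_trans _ _ 2%:E); last exact: ltry.
apply: lime_le.
  by apply: is_cvg_nneseries => n _ _; exact: integral_ge0.
apply: nearW => n; rewrite big_mkord.
apply: le_trans (_ : (\sum_(k < n) 2^-1 ^+ k)%:E <= _)%E; last first.
  by rewrite lee_fin; exact: geometric_half_le2.
rewrite -sumEFin; apply: lee_sum => k _.
have := u_fast k; rewrite -lee_fin; apply: le_trans.
by rewrite -(L1_funK (u k.+1)) -(L1_funK (u k)) -toL1B normL1E.
Qed.

Let fG n t : (`|f n t|%:E <= `|f 0%N t|%:E + G t)%E.
Proof.
apply: (@le_trans _ _ (`|f 0%N t|%:E + \sum_(0 <= k < n) h k t)%E); last first.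
  by rewrite leeD2l//; apply: nneseries_lim_ge => k _ _; exact: h_ge0.
elim: n => [|n ih]; first by rewrite big_geq ?adde0.
rewrite big_nat_recr// [X in (_ <= X)%E]addeA.
rewrite -[X in (`|X|%:E <= _)%E](subrK (f n t)) [X in `|X|]addrC.
rewrite (le_trans _ (leeD2r _ ih))// -EFinD lee_fin.
exact: ler_normD.
Qed.

Let f_cvg t : G t \is a fin_num -> cvgn (f ^~ t).
Proof.
move=> Gt.
have -> : f ^~ t = (fun n => f 0%N t + series (telescope (f ^~ t)) n).
  by apply/funext => n; exact: (eq_sum_telescope (fun k => f k t : R)).
apply: is_cvgD; first exact: is_cvg_cst.
apply: normed_cvg; apply: nondecreasing_is_cvgn.
  by apply: nondecreasing_series => n _ _ /=.
exists (fine (G t)) => _ [n _ <-]; rewrite -lee_fin fineK// /series /= -sumEFin.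
by apply: nneseries_lim_ge => k _ _; exact: h_ge0.
Qed.

Let F t := fine (limn_esup (fun n => (f n t)%:E)).

Let mF : measurable_fun setT F.
Proof.
apply/measurableT_comp => //; apply: measurable_fun_limn_esup => // n.
exact/measurable_EFinP.
Qed.

Let f_F t : G t \is a fin_num -> (f n t)%:E @[n --> \oo] --> (F t)%:E.
Proof.
move=> /f_cvg /cvg_ex[l fl].
have fl' : (f n t)%:E @[n --> \oo] --> l%:E by apply: cvg_EFin => //; exact: nearW.
by rewrite /F (cvg_limn_einf_sup fl').2.
Qed.

Lemma L1_fast_cvg : cvgn u.
Proof.
have /(integrable_ae measurableT) Gfin := iG.
have [|||||iF cF _] := @dominated_convergence _ T R mu setT measurableT
  (fun n => EFin \o f n) (EFin \o F) (fun t => `|f 0%N t|%:E + G t)%E.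
- by move=> n; exact/measurable_EFinP.
- exact/measurable_EFinP.
- by apply: filterS Gfin => t /(_ I) /f_F.
- apply: integrableD => //.
  have /Lfun1_integrable := LfunP (f 0%N).
  exact: integrable_norm.
- by apply: nearW => t n _; exact: fG.
have FL : F \in Lfun mu 1 by apply/Lfun1_integrable.
apply/cvg_ex; exists (toL1 (Lfun_Sub _ FL)).
apply/cvgrPdist_lt => e e_gt0.
have e0 : (0 < e%:E)%E by rewrite lte_fin.
move/fine_cvgP : cF => [_ /cvgrPdist_lt/(_ _ e_gt0)].
apply: filterS => n /=; rewrite sub0r normrN.
apply: le_lt_trans; apply: le_trans (ler_norm _).
set I := (X in fine X); have -> : I = `|u n - toL1 (Lfun_Sub _ FL)|%:E.
  by rewrite -[X in `|X - _|](L1_funK (u n)) -toL1B normL1E.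
by rewrite distrC.
Qed.
End L1_complete.

Let L1_complete (F : set_system L1) : ProperFilter F -> cauchy F -> cvg F.
Proof. exact: (fast_cauchy_complete L1_fast_cvg). Qed.

HB.instance Definition _ := Uniform_isComplete.Build L1 L1_complete.

Definition L1_le (x y : L1) := {ae mu, forall t, L1_fun x t <= L1_fun y t}.
Definition L1_join (x y : L1) : L1 := toL1 (LF_max (L1_fun x) (L1_fun y)).
Definition L1_meet (x y : L1) : L1 := toL1 (LF_min (L1_fun x) (L1_fun y)).

Lemma toL1_le (f g : LF) :
  L1_le (toL1 f) (toL1 g) <-> {ae mu, forall t, f t <= g t}.
Proof.
split; apply: filterS3 (toL1K f) (toL1K g) => t /(_ I) ef /(_ I) eg.
  by rewrite ef eg.
by rewrite ef eg.
Qed.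

Lemma toL1_join (f g : LF) : L1_join (toL1 f) (toL1 g) = toL1 (LF_max f g).
Proof.
apply/toL1_eqP; apply: filterS2 (toL1K f) (toL1K g) => t /(_ I) ef /(_ I) eg _.
exact: (congr2 Num.max ef eg).
Qed.

Lemma toL1_meet (f g : LF) : L1_meet (toL1 f) (toL1 g) = toL1 (LF_min f g).
Proof.
apply/toL1_eqP; apply: filterS2 (toL1K f) (toL1K g) => t /(_ I) ef /(_ I) eg _.
exact: (congr2 Num.min ef eg).
Qed.

Let L1_le_refl x : L1_le x x. Proof. exact: nearW. Qed.

Let L1_le_anti x y : L1_le x y -> L1_le y x -> x = y.
Proof.
rewrite -(L1_funK x) -(L1_funK y) !toL1_le => xy yx; apply/toL1_eqP.
by apply: filterS2 xy yx => t xy yx _; apply/eqP; rewrite eq_le xy yx.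
Qed.

Let L1_le_trans y x z : L1_le x y -> L1_le y z -> L1_le x z.
Proof. by apply: filterS2 => t; exact: le_trans. Qed.

Let L1_joinP x y z : L1_le (L1_join x y) z <-> L1_le x z /\ L1_le y z.
Proof.
have [[[f ->] [g ->]] [h ->]] := (L1P x, L1P y, L1P z).
rewrite toL1_join !toL1_le; split=> [fgh|[]].
  by split; apply: filterS fgh => t; rewrite ge_max => /andP[].
by apply: filterS2 => t fh gh; rewrite ge_max fh.
Qed.

Let L1_meetP x y z : L1_le z (L1_meet x y) <-> L1_le z x /\ L1_le z y.
Proof.
have [[[f ->] [g ->]] [h ->]] := (L1P x, L1P y, L1P z).
rewrite toL1_meet !toL1_le; split=> [fgh|[]].
  by split; apply: filterS fgh => t; rewrite le_min => /andP[].
by apply: filterS2 => t fh gh; rewrite le_min fh.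
Qed.

Let L1_leD2r z x y : L1_le x y -> L1_le (x + z) (y + z).
Proof.
have [[[f ->] [g ->]] [h ->]] := (L1P x, L1P y, L1P z).
by rewrite -!toL1D !toL1_le; apply: filterS => t fg; exact: lerD.
Qed.

Let L1_scale_ge0 (a : R) x : 0 <= a -> L1_le 0 x -> L1_le 0 (a *: x).
Proof.
have [f ->] := L1P x; rewrite -toL1Z => a0 /toL1_le f0; apply/toL1_le.
by apply: filterS f0 => t f0; exact: mulr_ge0.
Qed.

Let L1_norm_mono x y :
  L1_le (L1_join x (- x)) (L1_join y (- y)) -> `|x| <= `|y|.
Proof.
have [[f ->] [g ->]] := (L1P x, L1P y).
rewrite -!toL1N !toL1_join toL1_le -lee_fin !normL1E => fg.
apply: ae_ge0_le_integral => //.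
- by apply/measurable_EFinP/measurableT_comp => //; exact: LF_measurable.
- by apply/measurable_EFinP/measurableT_comp => //; exact: LF_measurable.
apply: filterS fg => t fg _; rewrite lee_fin.
by rewrite -!maxrN; exact: fg.
Qed.

HB.instance Definition _ := isBanachLattice.Build R L1
  L1_le_refl L1_le_anti L1_le_trans L1_joinP L1_meetP L1_leD2r
  L1_scale_ge0 L1_norm_mono.

End L1.

Section ell1.
Context (R : realType) (I : choiceType) (X : banachLatticeType R).

Record ell1 := Ell1 {
  ell1_fun :> I -> X ;
  ell1_finite : (\esum_(i in [set: I]) `|ell1_fun i|%:E < +oo)%E
}.

Local Notation es f := (\esum_(i in [set: I]) `|f i|%:E)%E.

Lemma ell1P (x y : ell1) : (forall i, x i = y i) -> x = y.
Proof.
case: x y => [f fP] [g gP] /= /funext fg; case: _ / fg in gP *.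
by congr Ell1; exact: Prop_irrelevance.
Qed.

Let es_ge0 (f : I -> X) : (0 <= es f)%E.
Proof. by apply: esum_ge0 => i _; rewrite lee_fin. Qed.

Let esD (f g : I -> X) (k : I -> X) :
  (forall i, `|k i| <= `|f i| + `|g i|) -> (es k <= es f + es g)%E.
Proof.
move=> kfg; rewrite -esumD; [|by move=> i _; rewrite lee_fin..].
by apply: le_esum => i _; rewrite -EFinD lee_fin.
Qed.

Let es_bound (f : I -> X) (c : \bar R) :
  (forall s : {fset I}, (\sum_(i <- s) `|f i|)%:E <= c)%E -> (es f <= c)%E.
Proof.
move=> fc; apply: ge_ereal_sup => _ [A [finA _] <-].
by rewrite fsbig_finite//= sumEFin; exact: fc.
Qed.

Let es_ge (f : I -> X) (s : {fset I}) : ((\sum_(i <- s) `|f i|)%:E <= es f)%E.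
Proof.
apply: ereal_sup_ubound; exists [set` s]; first by split.
by rewrite fsbig_finite//= sumEFin set_fsetK.
Qed.

Let esZ (a : R) (f : I -> X) : (es (fun i => a *: f i) <= `|a|%:E * es f)%E.
Proof.
apply: es_bound => s; under eq_bigr do rewrite normrZ.
by rewrite -mulr_sumr EFinM lee_wpmul2l// lee_fin.
Qed.

Let ell1_0_fin : (es (fun=> 0 : X) < +oo)%E.
Proof. by rewrite esum1// => i _; rewrite normr0. Qed.
Let ell1_opp_fin (x : ell1) : (es (fun i => - x i) < +oo)%E.
Proof.
by under eq_esum do rewrite normrN; exact: ell1_finite.
Qed.
Let esD_fin (x y : ell1) (k : I -> X) :
  (forall i, `|k i| <= `|x i| + `|y i|) -> (es k < +oo)%E.
Proof.
move=> /esD /le_lt_trans; apply.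
by rewrite lte_add_pinfty//; exact: ell1_finite.
Qed.
Let ell1_add_fin (x y : ell1) : (es (fun i => x i + y i) < +oo)%E.
Proof. by apply: (@esD_fin x y) => i; exact: ler_normD. Qed.
Let ell1_scale_fin (a : R) (x : ell1) : (es (fun i => a *: x i) < +oo)%E.
Proof.
apply: le_lt_trans (esZ a x) _.
by rewrite lte_mul_pinfty ?lee_fin//; exact: ell1_finite.
Qed.
Let ell1_join_fin (x y : ell1) : (es (fun i => vjoin (x i) (y i)) < +oo)%E.
Proof. by apply: (@esD_fin x y) => i; exact: norm_vjoin. Qed.
Let ell1_meet_fin (x y : ell1) : (es (fun i => vmeet (x i) (y i)) < +oo)%E.
Proof. by apply: (@esD_fin x y) => i; exact: norm_vmeet. Qed.

Let ell1_0 := Ell1 ell1_0_fin.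
Let ell1_opp x := Ell1 (ell1_opp_fin x).
Let ell1_add x y := Ell1 (ell1_add_fin x y).
Let ell1_scale a x := Ell1 (ell1_scale_fin a x).
Definition ell1_le (x y : ell1) := forall i, vle (x i) (y i).
Definition ell1_join x y := Ell1 (ell1_join_fin x y).
Definition ell1_meet x y := Ell1 (ell1_meet_fin x y).
Definition ell1_norm (x : ell1) : R := fine (es x).

HB.instance Definition _ := gen_eqMixin ell1.
HB.instance Definition _ := gen_choiceMixin ell1.

Let ell1_addA : associative ell1_add.
Proof. by move=> x y z; apply: ell1P => i /=; rewrite addrA. Qed.
Let ell1_addC : commutative ell1_add.
Proof. by move=> x y; apply: ell1P => i /=; rewrite addrC. Qed.
Let ell1_add0 : left_id ell1_0 ell1_add.
Proof. by move=> x; apply: ell1P => i /=; rewrite add0r. Qed.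
Let ell1_addN : left_inverse ell1_0 ell1_opp ell1_add.
Proof. by move=> x; apply: ell1P => i /=; rewrite addNr. Qed.

HB.instance Definition _ := GRing.isZmodule.Build ell1
  ell1_addA ell1_addC ell1_add0 ell1_addN.

Let ell1_scaleA a b x : ell1_scale a (ell1_scale b x) = ell1_scale (a * b) x.
Proof. by apply: ell1P => i /=; rewrite scalerA. Qed.
Let ell1_scale1 : left_id 1 ell1_scale.
Proof. by move=> x; apply: ell1P => i /=; rewrite scale1r. Qed.
Let ell1_scaleDr : right_distributive ell1_scale +%R.
Proof. by move=> a x y; apply: ell1P => i /=; rewrite scalerDr. Qed.
Let ell1_scaleDl x : {morph ell1_scale^~ x : a b / a + b}.
Proof. by move=> a b; apply: ell1P => i /=; rewrite scalerDl. Qed.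

HB.instance Definition _ := GRing.Zmodule_isLmodule.Build R ell1
  ell1_scaleA ell1_scale1 ell1_scaleDr ell1_scaleDl.

Lemma ell1_normE (x : ell1) : ((ell1_norm x)%:E = es x)%E.
Proof.
by rewrite fineK// ge0_fin_numE//; exact: ell1_finite.
Qed.

Let ell1_normD (x y : ell1) : ell1_norm (x + y) <= ell1_norm x + ell1_norm y.
Proof.
by rewrite -lee_fin EFinD !ell1_normE; apply: esD => i; exact: ler_normD.
Qed.

Let ell1_normZ_le (a : R) (x : ell1) : ell1_norm (a *: x) <= `|a| * ell1_norm x.
Proof. by rewrite -lee_fin EFinM !ell1_normE; exact: esZ. Qed.

Let ell1_norm0_eq0 (x : ell1) : ell1_norm x = 0 -> x = 0.
Proof.
move=> x0; apply: ell1P => i; apply/eqP; rewrite -normr_le0 -x0 -lee_fin.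
rewrite ell1_normE.
by have := es_ge x [fset i]%fset; rewrite big_seq_fset1.
Qed.

Let ell1_normZ (a : R) (x : ell1) : ell1_norm (a *: x) = `|a| * ell1_norm x.
Proof.
apply/eqP; rewrite eq_le ell1_normZ_le /=.
have [->|a0] := eqVneq a 0.
  by rewrite normr0 mul0r -lee_fin ell1_normE es_ge0.
have na : 0 < `|a| by rewrite normr_gt0.
rewrite -ler_pdivlMl// -normfV -{1}(scale1r x) -(mulVf a0) -scalerA.
exact: ell1_normZ_le.
Qed.

HB.instance Definition _ := Lmodule_isNormed.Build R ell1
  ell1_normD ell1_normZ ell1_norm0_eq0.

Lemma normell1E (x : ell1) : (`|x|%:E = es x)%E.
Proof. exact: ell1_normE. Qed.

Lemma sum_norm_ell1 (x : ell1) (s : {fset I}) : \sum_(i <- s) `|x i| <= `|x|.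
Proof. by rewrite -lee_fin normell1E. Qed.

Lemma norm_coord_ell1 (x : ell1) i : `|x i| <= `|x|.
Proof. by have := sum_norm_ell1 x [fset i]%fset; rewrite big_seq_fset1. Qed.

Lemma ell1_fast_cvg (u : nat -> ell1) :
  (forall n, `|u n.+1 - u n| <= 2^-1 ^+ n) -> cvgn u.
Proof.
move=> u_fast.
have /choice[l ul] : forall i, exists l : X, u n i @[n --> \oo] --> l.
  move=> i; apply/cvg_ex; apply: fast_cvg => n.
  by apply: le_trans (u_fast n); exact: (norm_coord_ell1 (u n.+1 - u n) i).
have tail n : (es (fun i => l i - u n i) <= (2 * 2^-1 ^+ n)%:E)%E.
  apply: es_bound => s; rewrite lee_fin.
  have cs (r : seq I) : (\sum_(i <- r) `|u m i - u n i|) @[m --> \oo] -->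
      \sum_(i <- r) `|l i - u n i|.
    elim: r => [|i r ih].
      by under eq_fun do rewrite big_nil; rewrite big_nil; exact: cvg_cst.
    under eq_fun do rewrite big_cons; rewrite big_cons; apply: cvgD ih.
    by apply: cvg_norm; apply: cvgB (ul i) _; exact: cvg_cst.
  rewrite -(cvg_lim _ (cs s))//; apply: limr_le.
    by apply/cvg_ex; eexists; exact: cs.
  exists n => // m /= nm; apply: le_trans (fast_tail u_fast nm).
  exact: (sum_norm_ell1 (u m - u n) s).
have dfin n : (es (fun i => l i - u n i) < +oo)%E.
  exact: le_lt_trans (tail n) (ltry _).
have lfin : (es l < +oo)%E.
  apply: (@esD_fin (Ell1 (dfin 0%N)) (u 0%N)) => i /=.
  by rewrite -{1}(subrK (u 0%N i) (l i)); exact: ler_normD.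
apply/cvg_ex; exists (Ell1 lfin); apply/cvgrPdist_le => e e0.
have h2 : (fun n => 2 * 2^-1 ^+ n : R) @ \oo --> 0.
  rewrite -[X in _ --> X](mulr0 2); apply: cvgMr; apply: cvg_expr.
  by rewrite ger0_norm// invf_lt1// ltr1n.
move/cvgrPdist_le : h2 => /(_ _ e0); apply: filterS => n.
rewrite sub0r normrN; apply: le_trans; apply: le_trans (ler_norm _).
by rewrite -lee_fin normell1E; exact: tail.
Qed.

Let ell1_complete (F : set_system ell1) : ProperFilter F -> cauchy F -> cvg F.
Proof. exact: (fast_cauchy_complete ell1_fast_cvg). Qed.

HB.instance Definition _ := Uniform_isComplete.Build ell1 ell1_complete.

Let ell1_le_refl x : ell1_le x x. Proof. by move=> i; exact: vle_refl. Qed.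
Let ell1_le_anti x y : ell1_le x y -> ell1_le y x -> x = y.
Proof. by move=> xy yx; apply: ell1P => i; exact: vle_anti. Qed.
Let ell1_le_trans y x z : ell1_le x y -> ell1_le y z -> ell1_le x z.
Proof. by move=> xy yz i; exact: vle_trans (xy i) (yz i). Qed.
Let ell1_joinP x y z :
  ell1_le (ell1_join x y) z <-> ell1_le x z /\ ell1_le y z.
Proof.
split=> [xyz|[xz yz] i]; last by apply/vjoinP; split; [exact: xz|exact: yz].
by split=> i; have /vjoinP[] := xyz i.
Qed.
Let ell1_meetP x y z :
  ell1_le z (ell1_meet x y) <-> ell1_le z x /\ ell1_le z y.
Proof.
split=> [xyz|[xz yz] i]; last by apply/vmeetP; split; [exact: xz|exact: yz].
by split=> i; have /vmeetP[] := xyz i.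
Qed.
Let ell1_leD2r z x y : ell1_le x y -> ell1_le (x + z) (y + z).
Proof. by move=> xy i; exact: (vleD2r (z i) (xy i)). Qed.
Let ell1_scale_ge0 (a : R) x : 0 <= a -> ell1_le 0 x -> ell1_le 0 (a *: x).
Proof. by move=> a0 x0 i; exact: (vscale_ge0 a0 (x0 i)). Qed.
Let ell1_norm_mono (x y : ell1) :
  ell1_le (ell1_join x (- x)) (ell1_join y (- y)) -> `|x| <= `|y|.
Proof.
move=> xy; rewrite -lee_fin !normell1E; apply: le_esum => i _.
by rewrite lee_fin; apply: vnorm_mono; exact: xy.
Qed.

HB.instance Definition _ := isBanachLattice.Build R ell1
  ell1_le_refl ell1_le_anti ell1_le_trans ell1_joinP ell1_meetP ell1_leD2r
  ell1_scale_ge0 ell1_norm_mono.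

End ell1.

Section cube.
Context (R : realType) (I : choiceType).

Definition unit_interval : Type := {x : R | 0 <= x <= 1}.

Lemma unit_interval0 : 0 <= (0 : R) <= 1.
Proof. by rewrite lexx ler01. Qed.

HB.instance Definition _ := Choice.on unit_interval.
HB.instance Definition _ :=
  isPointed.Build unit_interval (exist _ 0 unit_interval0).

Definition cube : Type := I -> unit_interval.
HB.instance Definition _ := Pointed.on cube.

(* The product measure is obtained by Caratheodory's method from the outer
   measure given by countable covers by measurable boxes.  The pair (s, B)
   encodes the box of the x with x i in B i for i in the finite set s, the sides
   B i for i outside s being ignored; only B i `&` `[0, 1] matters.  A cover is a
   sequence in which None stands for the empty set, so that finite covers are
   allowed. *)
Definition box_data : Type := ({fset I} * (I -> set R))%type.

Definition box (c : box_data) : set cube :=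
  [set x | forall i, i \in c.1 -> c.2 i (val (x i))].

Definition box_volume (c : box_data) : \bar R :=
  (\prod_(i <- c.1) fine (lebesgue_measure (c.2 i `&` `[0, 1])))%:E.

Definition box_cover (A : set cube) : set (nat -> option box_data) :=
  [set c | (forall k b, c k = Some b -> forall i, measurable (b.2 i)) /\
           A `<=` \bigcup_k oapp box set0 (c k)].

Definition cube_outer (A : set cube) : \bar R :=
  ereal_inf [set (\sum_(k <oo) oapp box_volume 0 (c k))%E | c in box_cover A].

Let vol (c : option box_data) := oapp box_volume 0%E c.

Let vol_ge0 c : (0 <= vol c)%E.
Proof.
case: c => [c|//]; rewrite lee_fin.
by apply: prodr_ge0 => i _; apply: fine_ge0; exact: measure_ge0.
Qed.

Let cube_outer0 : cube_outer set0 = 0%E.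
Proof.
apply/eqP; rewrite eq_le; apply/andP; split.
  apply: ereal_inf_lbound; exists (fun=> None); first by split.
  by rewrite eseries0.
by apply: le_ereal_inf_tmp => x [c _ <-]; apply: nneseries_ge0 => n _ _; exact: vol_ge0.
Qed.

Let cube_outer_ge0 A : (0 <= cube_outer A)%E.
Proof.
apply: le_ereal_inf_tmp => x [c _ <-].
by apply: nneseries_ge0 => n _ _; exact: vol_ge0.
Qed.

Let le_cube_outer : {homo cube_outer : A B / A `<=` B >-> (A <= B)%E}.
Proof.
move=> A B AB; apply/ereal_inf_le_tmp => x [c [mc Bc]] <-.
by exists c => //; split => //; exact: subset_trans Bc.
Qed.

Local Open Scope ereal_scope.

Let cube_outer_sigma_subadditive : sigma_subadditive cube_outer.
Proof.
move=> A; have [[i ioo]|] := pselect (exists i, cube_outer (A i) = +oo).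
  rewrite (eseries_pinfty _ _ ioo) ?leey// => n _.
  by rewrite -ltNye (lt_le_trans _ (cube_outer_ge0 _)).
rewrite -forallNE => Aoo.
apply/lee_addgt0Pr => _/posnumP[e].
apply: le_trans (epsilon_trick xpredT (fun n => cube_outer_ge0 (A n)) _) => //.
pose P n (c : nat -> option box_data) := box_cover (A n) c /\
  \sum_(k <oo) vol (c k) <= cube_outer (A n) + (e%:num / (2 ^ n.+1)%:R)%:E.
have [G PG] : {G : nat -> nat -> option box_data & forall n, P n (G n)}.
  apply: (@choice _ _ P) => n; rewrite /P /cube_outer.
  set S := (X in ereal_inf X); move infS : (ereal_inf S) => iS.
  case: iS infS => [r Sr|Soo|Soo].
  - have en1 : (0 < e%:num / (2 ^ n.+1)%:R)%R by [].
    have /(lb_ereal_inf_adherent en1) : ereal_inf S \is a fin_num by rewrite Sr.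
    move=> [x [c Anc muc] xS].
    by exists c; split => //; move: xS; rewrite -muc Sr => /ltW.
  - by have := Aoo n; rewrite /cube_outer -/S Soo.
  - suff : lbound S 0 by move/le_ereal_inf_tmp; rewrite Soo.
    by move=> /= _ [c _ <-]; apply: nneseries_ge0 => k _ _; exact: vol_ge0.
apply: (@le_trans _ _ (\esum_(i in [set: nat * nat]) (vol \o uncurry G) i)).
  apply: ereal_inf_lbound => /=.
  have /card_esym/ppcard_eqP[f] := card_nat2.
  exists (uncurry G \o f).
    split => [k b|].
      by rewrite /= /uncurry; case: (f k) => n m; exact: (PG n).1.1.
    move=> t [n _ /(PG n).1.2 [m _ Gt]]; exists (f^-1%FUN (n, m)) => //=.
    by rewrite invK ?inE.
  rewrite -(esum_pred_image (vol \o uncurry G) _ xpredT) ?[fun=> _]set_true//; last first.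
    by move=> n _; exact: vol_ge0.
  by rewrite image_eq.
have -> : \esum_(i in [set: nat * nat]) (vol \o uncurry G) i =
    \sum_(i <oo) \sum_(j <oo) vol (G i j).
  rewrite nneseries_esumT; last first.
    by move=> n; apply: nneseries_ge0 => m _ _; exact: vol_ge0.
  under [RHS]eq_esum do rewrite nneseries_esumT//.
  rewrite esum_esum//.
  have -> : [set: nat] `*`` (fun=> [set: nat]) = [set: nat * nat].
    by apply/seteqP; split.
  by apply: eq_esum => -[i j].
apply: lee_nneseries => [n _ _|n _]; last exact: (PG n).2.
by apply: nneseries_ge0 => m _ _; exact: vol_ge0.
Qed.

HB.instance Definition _ := isOuterMeasure.Build R cube cube_outer
  cube_outer0 cube_outer_ge0 le_cube_outer cube_outer_sigma_subadditive.

Definition cube_outer_measure : {outer_measure set cube -> \bar R} :=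
  cube_outer.

Definition cube_measure :
    {measure set (caratheodory_type cube_outer_measure) -> \bar R} :=
  [the {measure set (caratheodory_type cube_outer_measure) -> \bar R} of
   (cube_outer_measure : set (caratheodory_type cube_outer_measure) -> \bar R)].

End cube.

Definition separable (T : topologicalType) :=
  exists2 A : set T, countable A & dense A.

Definition separable_L1 (R : realType) (S : banachLatticeType R) :=
  separable S /\
  exists (d : measure_display) (T : measurableType d)
    (nu : {measure set T -> \bar R}), lattice_isometric S (L1 nu).

(* Main.v *)
(** By Zorn's lemma there is a maximal isometric lattice homomorphism from a
    sublattice D of L_1(nu) to X extending the given one, and D is closed.
    - If B is measurable, the functional "integrate over B" on the image of D
      extends by Hahn-Banach to X and has there a density k with 0 <= k <= 1.
      Separability makes the countably many data involved depend on countably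
      many coordinates of the cube; if j is another coordinate, restricting to
      the set where x_j < k multiplies all the integrals by k.  Hence the
      homomorphism extends to 1_B D + 1_B^c D, so that D is stable under 1_B.
    - If w >= 0 vanishes wherever D does not, it can be sent to a multiple of
      the constant 1 in a copy of L_1 in which the image of D vanishes, so that
      w = 0.
    Therefore D is a closed ideal whose disjoint complement is 0, i.e. D is all
    of L_1(nu). *)
From HB Require Import structures.
Require Import Defs.
From mathcomp Require Import all_boot all_order all_algebra.
From mathcomp Require Import finmap ring lra.
From mathcomp Require Import all_classical all_reals all_analysis measurable_realfun.
Local Open Scope classical_set_scope.
Local Open Scope card_scope.

Set Implicit Arguments.
Unset Strict Implicit.
Unset Printing Implicit Defensive.

Import Order.TTheory GRing.Theory Num.Theory.
Import numFieldNormedType.Exports.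
Local Open Scope ring_scope.

(** * Banach lattices *)

(** Multiplication by the density k has the right integrals, but gluing with it would not respect
    joins; this requires an indicator, and trading k for the indicator of the set where x_j < k is
    the purpose of the cube. Norms are integrals of absolute values, so equality of integrals on
    corresponding elements is enough for the glued map to be isometric. The Hahn-Banach majorant is
    the norm of the positive part: domination by it says at once that the functional is positive and
    at most the norm, that is 0 <= k <= 1. The two kinds of integrals are compared on a countable
    dense part of the graph. Its elements meet countably many summands and exclude countably many
    coordinates j in each, so one j serves all summands together. The same count leaves a free
    summand for w; what is disjoint from the current domain bears no relation to it, and a new
    summand gives it room without disturbing the norms already fixed. Partial homomorphisms are
    graphs, so that unions of chains and closures are plain set operations; isometry makes them
    single-valued. *)

Section vector_lattice.
Context (R : realType) (V : banachLatticeType R).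
Implicit Types x y z : V.

Lemma vle_sub x y : vle x y <-> vle 0 (y - x).
Proof.
split=> [/(vleD2r (- x))|/(vleD2r x)]; first by rewrite subrr.
by rewrite add0r subrK.
Qed.

Lemma vjoin_le x y z : vle x z -> vle y z -> vle (vjoin x y) z.
Proof. by move=> xz yz; apply/vjoinP. Qed.

Lemma vjoin_r x y : vle x y -> vjoin x y = y.
Proof.
move=> xy; apply: vle_anti; last exact: vle_joinr.
by apply: vjoin_le => //; exact: vle_refl.
Qed.

Lemma vjoin_l x y : vle y x -> vjoin x y = x.
Proof.
move=> xy; apply: vle_anti; last exact: vle_joinl.
by apply: vjoin_le => //; exact: vle_refl.
Qed.

Lemma vjoinxx x : vjoin x x = x.
Proof. by apply: vjoin_r; exact: vle_refl. Qed.

Lemma vjoinD x y z : vjoin x y + z = vjoin (x + z) (y + z).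
Proof.
apply: vle_anti; last first.
  by apply: vjoin_le; apply: vleD2r; [exact: vle_joinl|exact: vle_joinr].
rewrite -[X in vle _ X](subrK z); apply: vleD2r.
by apply: vjoin_le; rewrite -[X in vle X _](addrK z); apply: vleD2r;
  [exact: vle_joinl|exact: vle_joinr].
Qed.

Lemma vscale_le (a : R) x y : 0 <= a -> vle x y -> vle (a *: x) (a *: y).
Proof.
by move=> a0 /vle_sub /(vscale_ge0 a0) h; apply/vle_sub; rewrite -scalerBr.
Qed.

Lemma vjoinZ (a : R) x y : 0 <= a ->
  a *: vjoin x y = vjoin (a *: x) (a *: y).
Proof.
rewrite le_eqVlt => /predU1P[<-|a0]; first by rewrite !scale0r vjoinxx.
apply: vle_anti; last first.
  by apply: vjoin_le; apply: vscale_le; rewrite ?ltW//;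
    [exact: vle_joinl|exact: vle_joinr].
rewrite -[X in vle _ X](scalerKV (lt0r_neq0 a0)); apply: vscale_le; first exact: ltW.
by apply: vjoin_le; rewrite -[X in vle X _](scalerK (lt0r_neq0 a0));
  apply: vscale_le; rewrite ?invr_ge0 ?ltW//; [exact: vle_joinl|exact: vle_joinr].
Qed.

Lemma vmeetE x y : vmeet x y = - vjoin (- x) (- y).
Proof.
apply: vle_anti.
  rewrite -[X in vle X _]opprK; apply: vleN; apply: vjoin_le; apply: vleN.
    exact: vle_meetl.
  exact: vle_meetr.
apply/vmeetP; split; rewrite -[X in vle _ X]opprK; apply: vleN.
  exact: vle_joinl.
exact: vle_joinr.
Qed.

Definition vpos x := vjoin x 0.

Lemma vpos_ge0 x : vle 0 (vpos x). Proof. exact: vle_joinr. Qed.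

Lemma vposB x : vpos x - vpos (- x) = x.
Proof.
rewrite -[X in _ = X](addrK (vpos (- x))); congr (_ - _).
rewrite addrC /vpos vjoinD addNr add0r; apply: vle_anti.
  by apply: vjoin_le; [exact: vle_joinr|exact: vle_joinl].
by apply: vjoin_le; [exact: vle_joinr|exact: vle_joinl].
Qed.

Lemma vabsE x : vabs x = vpos x + vpos (- x).
Proof.
rewrite -[LHS](addrK x).
have -> : vabs x + x = vpos x + vpos x.
  rewrite /vabs vjoinD addNr -[vpos x in RHS]scale1r -scalerDl vjoinZ//.
  by rewrite scaler0 scalerDl scale1r.
rewrite -addrA; congr (_ + _).
by rewrite -{2}(vposB x) opprB addrCA subrr addr0.
Qed.

Lemma vabs_id x : vle 0 x -> vabs x = x.
Proof.
move=> x0; apply: vjoin_l; apply: (vle_trans _ x0).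
by rewrite -[X in vle _ X]oppr0; exact: vleN.
Qed.

Lemma vpos_id x : vle 0 x -> vpos x = x.
Proof. exact: vjoin_l. Qed.

Lemma vpos_eq0 x : vle x 0 -> vpos x = 0.
Proof. exact: vjoin_r. Qed.

Lemma norm_vabs x : `|vabs x| = `|x|.
Proof.
apply/eqP; rewrite eq_le norm_vabs_le /=; apply: vnorm_mono.
rewrite -!/(vabs _) [vabs (vabs x)]vabs_id; [exact: vle_refl|exact: vabs_ge0].
Qed.

Lemma norm_le_ge0 x y : vle 0 x -> vle x y -> `|x| <= `|y|.
Proof.
move=> x0 xy; apply: vnorm_mono; rewrite -!/(vabs _) !vabs_id//.
exact: vle_trans xy.
Qed.

Lemma vle_vabs x : vle x (vabs x). Proof. exact: vle_joinl. Qed.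

Lemma vleDl x y : vle 0 y -> vle x (x + y).
Proof. by move=> /(vleD2r x); rewrite add0r addrC. Qed.

Lemma norm_vjoinB x y x' y' :
  `|vjoin x y - vjoin x' y'| <= `|x - x'| + `|y - y'|.
Proof.
have half (a b a' b' : V) :
    vle (vjoin a b - vjoin a' b') (vabs (a - a') + vabs (b - b')).
  apply/vle_sub; rewrite opprB addrA; apply/(vle_sub (vjoin a b)).
  rewrite addrC; apply: vjoin_le.
    rewrite -[X in vle X _](subrK a') [X in vle X _]addrC; apply: vleD; first exact: vle_joinl.
    by apply: vle_trans (vle_vabs _) _; apply: vleDl; exact: vabs_ge0.
  rewrite -[X in vle X _](subrK b') [X in vle X _]addrC; apply: vleD; first exact: vle_joinr.
  apply: vle_trans (vle_vabs _) _; rewrite [X in vle _ X]addrC; apply: vleDl; exact: vabs_ge0.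
apply: norm_vle_bound; first exact: half.
rewrite opprB; have := half x' y' x y.
have vabsN z : vabs (- z) = vabs z by rewrite !vabsE opprK addrC.
by rewrite -(vabsN (x - x')) -(vabsN (y - y')) !opprB.
Qed.

(** With [norm_vposZ], this makes the norm of the positive part a sublinear functional; it will be
    the Hahn-Banach majorant. *)
Lemma norm_vpos_sub x y : `|vpos (x + y)| <= `|vpos x| + `|vpos y|.
Proof.
apply: le_trans (ler_normD _ _); apply: norm_le_ge0; first exact: vpos_ge0.
apply: vjoin_le; first by apply: vleD; exact: vle_joinl.
by rewrite -[X in vle X _](addr0 0); apply: vleD; exact: vpos_ge0.
Qed.

Lemma norm_vposZ (a : R) x : 0 <= a -> `|vpos (a *: x)| = a * `|vpos x|.
Proof.
by move=> a0; rewrite /vpos -{1}(scaler0 _ a) -vjoinZ// normrZ ger0_norm.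
Qed.

Lemma norm_vpos_le x : `|vpos x| <= `|x|.
Proof.
rewrite -(norm_vabs x); apply: norm_le_ge0; first exact: vpos_ge0.
by rewrite vabsE; apply: vleDl; exact: vpos_ge0.
Qed.

End vector_lattice.

(** The defining property of abstract L-spaces. The extension arguments on graphs rest on it, and so
    treat L_1 spaces and their l_1-sums alike. *)
Definition AL_space (R : realType) (V : banachLatticeType R) :=
  forall x y : V, vle 0 x -> vle 0 y -> `|x + y| = `|x| + `|y|.

(** * Integration and functionals on abstract L-spaces *)

Section AL_functional.
Context (R : realType) (V : banachLatticeType R).
Implicit Types x y : V.

(* On an L_1-space this is integration. *)
Definition aint x : R := `|vpos x| - `|vpos (- x)|.

Lemma aint_ge0E x : vle 0 x -> aint x = `|x|.
Proof.
move=> x0; rewrite /aint vpos_id// vpos_eq0 ?normr0 ?subr0//.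
by rewrite -[X in vle _ X]oppr0; exact: vleN.
Qed.

Lemma aintN x : aint (- x) = - aint x.
Proof. by rewrite /aint opprK opprB. Qed.

Lemma aint_le_vpos x : aint x <= `|vpos x|.
Proof. by rewrite /aint lerBlDr lerDl. Qed.

Lemma aint_le x : aint x <= `|x|.
Proof. by apply: le_trans (aint_le_vpos x) _; exact: norm_vpos_le. Qed.

Lemma norm_aint x : `|aint x| <= `|x|.
Proof. by rewrite ler_norml lerNl -aintN -{1}normrN !aint_le. Qed.

Lemma aint_vabs x : aint (vabs x) = `|x|.
Proof. by rewrite aint_ge0E ?norm_vabs//; exact: vabs_ge0. Qed.

Hypothesis AL : AL_space V.

Lemma aintD x y : aint (x + y) = aint x + aint y.
Proof.
(* The decompositions into positive and negative parts, rearranged without subtraction so that the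
   norm is additive on each side. *)
have e : vpos (x + y) + (vpos (- x) + vpos (- y)) =
    vpos (- (x + y)) + (vpos x + vpos y).
  apply/eqP; rewrite -subr_eq0 opprD addrACA vposB opprD addrACA.
  rewrite addrACA [X in _ + X]addrACA.
by rewrite -[_ - vpos x]opprB vposB -[_ - vpos y]opprB vposB addrACA !subrr addr0.
have p2 (u v : V) : vle 0 (vpos u + vpos v).
  by rewrite -[X in vle X _](addr0 0); apply: vleD; exact: vpos_ge0.
have n2 u v := AL (vpos_ge0 u) (vpos_ge0 v).
have n3 u v w := AL (vpos_ge0 u) (p2 v w).
have := congr1 Num.norm e; rewrite !n3 !n2 /aint; lra.
Qed.

Lemma aintZ (a : R) x : aint (a *: x) = a * aint x.
Proof.
have pos b : 0 <= b -> aint (b *: x) = b * aint x.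
  by move=> b0; rewrite /aint -scalerN !norm_vposZ// mulrBr.
have [/pos//|a0] := leP 0 a.
by rewrite -[a]opprK scaleNr aintN pos ?mulNr// oppr_ge0 ltW.
Qed.

Lemma aintB x y : aint (x - y) = aint x - aint y.
Proof. by rewrite aintD aintN. Qed.

End AL_functional.

Lemma aint_mono (R : realType) (V : banachLatticeType R) (x y : V) :
  AL_space V -> vle x y -> aint x <= aint y.
Proof.
by move=> AL /vle_sub xy; rewrite -subr_ge0 -aintB// aint_ge0E.
Qed.

Lemma AL_aint_comp_lin (R : realType) (V W : banachLatticeType R) (P : V -> W) :
  AL_space W -> (forall (a : R) y z, P (a *: y + z) = a *: P y + P z) ->
  forall (a : R) y z, aint (P (a *: y + z)) = a * aint (P y) + aint (P z).
Proof. by move=> AL P_lin a y z; rewrite P_lin aintD// aintZ. Qed.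

Lemma norm_aint_sub (R : realType) (V W : banachLatticeType R) (P Q : V -> W) y :
  `|P y| <= `|y| -> `|Q y| <= `|y| -> `|aint (P y) - aint (Q y)| <= 2 * `|y|.
Proof.
move=> Py Qy; apply: le_trans (ler_normB _ _) _.
have h1 := le_trans (norm_aint _) Py; have h2 := le_trans (norm_aint _) Qy; lra.
Qed.

Lemma sub_aint_lin (R : realType) (V W : banachLatticeType R) (phi : V -> R)
    (P : V -> W) : AL_space W ->
  (forall a y z, phi (a *: y + z) = a * phi y + phi z) ->
  (forall (a : R) y z, P (a *: y + z) = a *: P y + P z) ->
  forall a y z, phi (a *: y + z) - aint (P (a *: y + z)) =
    a * (phi y - aint (P y)) + (phi z - aint (P z)).
Proof.
by move=> AL phi_lin P_lin a y z; rewrite phi_lin P_lin aintD// aintZ; ring.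
Qed.

Lemma functional_eq0 (R : realType) (V : normedModType R) (phi : V -> R) (M : R)
    (x : V) :
  (forall (a : R) y z, phi (a *: y + z) = a * phi y + phi z) ->
  (forall y, `|phi y| <= M * `|y|) ->
  (forall e : R, 0 < e -> exists2 p, phi p = 0 & `|x - p| < e) -> phi x = 0.
Proof.
move=> phi_lin phi_bd px; apply/eqP; rewrite -normr_le0.
apply/ler_addgt0Pr => e e0; rewrite add0r.
(* [M] may be zero or negative, while its absolute value plus 1 is a positive bound in all cases. *)
have M1 : 0 < `|M| + 1 by rewrite ltr_wpDl.
have [p p0 xp] := px _ (divr_gt0 e0 M1).
have -> : phi x = phi (x - p).
  by rewrite addrC -scaleN1r phi_lin p0 mulr0 add0r.
apply: le_trans (phi_bd _) _; apply: (@le_trans _ _ ((`|M| + 1) * `|x - p|)).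
  by rewrite ler_wpM2r// (le_trans (ler_norm _))// lerDl.
by rewrite mulrC -ler_pdivlMr// ltW.
Qed.

(** [F] is the graph of a partial functional. Single-valuedness follows from domination: two values
    at the same point differ by a value at 0, which [p 0 = 0] bounds from both sides. A maximal
    dominated linear graph is defined everywhere, since any missing direction can be adjoined. *)
Lemma hahn_banach (R : realType) (V : lmodType R) (p : V -> R)
    (F : set (V * R)) :
  (forall x y, p (x + y) <= p x + p y) ->
  (forall a x, 0 <= a -> p (a *: x) = a * p x) ->
  (forall a u v, F u -> F v -> F (a *: u.1 + v.1, a * u.2 + v.2)) ->
  (forall u, F u -> u.2 <= p u.1) ->
  exists L : V -> R, [/\ forall a x y, L (a *: x + y) = a * L x + L y,
    forall x, L x <= p x & forall u, F u -> L u.1 = u.2].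
Proof.
move=> pD pZ Flin Fp.
pose good (G : set (V * R)) := [/\ G (0, 0), F `<=` G,
  forall a u v, G u -> G v -> G (a *: u.1 + v.1, a * u.2 + v.2) &
  forall u, G u -> u.2 <= p u.1].
have p0 : p 0 = 0 by rewrite -(scale0r 0) pZ// mul0r.
pose F0 := F `|` [set (0, 0)].
have goodF0 : good F0.
  split; [by right|by left| |]; last first.
    by move=> u [/Fp//|->] /=; rewrite p0.
  move=> a u v [Fu|->] [Fv|->] /=; rewrite ?(scaler0, mulr0, add0r, addr0).
  - by left; exact: Flin.
  (* The origin need not lie in [F], so [a u] is obtained as [(a - 1) u + u]. *)
  - left; have := Flin (a - 1) _ _ Fu Fu; rewrite scalerBl mulrBl scale1r mul1r.
    by rewrite !subrK.
  - by left; case: v Fv.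
  - by right.
pose P (G : set (V * R)) := G = set0 \/ good G.
have [|G [PG Gmax]] := @Zorn_bigcup _ P.
  move=> C CP Ctot.
  have [[G0 [CG0 gG0]]|none] := pselect (exists G, C G /\ good G); last first.
    left; apply/seteqP; split=> // u [G CG Gu].
    by have [G0|gG] := CP _ CG; [rewrite G0 in Gu|case: none; exists G].
  have gd G u : C G -> G u -> good G.
    by move=> CG Gu; have [G0'|//] := CP _ CG; rewrite G0' in Gu.
  right; split.
  - by exists G0 => //; case: gG0.
  - by move=> u Fu; exists G0 => //; case: gG0 => _ + _ _; apply.
  - move=> a u v [G1 CG1 Gu] [G2 CG2 Gv].
    have [_ _ lin1 _] := gd _ _ CG1 Gu; have [_ _ lin2 _] := gd _ _ CG2 Gv.
    have [s12|s21] := Ctot _ _ CG1 CG2.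
      by exists G2 => //; apply: lin2 => //; exact: s12.
    by exists G1 => //; apply: lin1 => //; exact: s21.
  - by move=> u [G1 CG1 Gu]; have [_ _ _] := gd _ _ CG1 Gu; exact.
have gG : good G.
  case: PG => // G0; exfalso; apply: (Gmax F0); last by right.
  rewrite G0; split; first by move=> ?.
  by move=> /(_ (0, 0)); apply; right.
have [G00 FG Glin Gp] := gG.
have Gtot x : exists r, G (x, r).
  apply: contrapT => /forallNP nx.
  (* The value c at x has to lie between these two families of bounds. *)
  have [c [cl cu]] : exists c, (forall u, G u -> u.2 - p (u.1 - x) <= c) /\
      (forall u, G u -> c <= p (u.1 + x) - u.2).
    have key u v : G u -> G v -> u.2 - p (u.1 - x) <= p (v.1 + x) - v.2.
      move=> Gu Gv; have := Gp _ (Glin 1 _ _ Gu Gv); rewrite scale1r mul1r /=.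
      have := pD (u.1 - x) (v.1 + x).
      by rewrite addrACA [- x + x]addrC subrr addr0; lra.
    pose S := [set u.2 - p (u.1 - x) | u in G].
    have S0 : S !=set0 by exists (0 - p (0 - x)); exists (0, 0).
    have Sub v : G v -> ubound S (p (v.1 + x) - v.2).
      by move=> Gv _ [u Gu <-]; exact: key.
    exists (sup S); split=> [u Gu|v Gv].
      by apply: ub_le_sup; [exists (p (0 + x) - 0); exact: (Sub (0, 0))|exists u].
    by apply: ge_sup => //; exact: Sub.
  pose G' := [set w | exists u t, G u /\ w = (u.1 + t *: x, u.2 + t * c)].
  apply: (Gmax G'); first split.
  - by move=> u Gu; exists u, 0; rewrite scale0r mul0r !addr0; split=> //; case: u Gu.
  - move=> /(_ (x, c)) GG; apply: (nx c); apply: GG.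
    by exists (0, 0), 1; rewrite scale1r mul1r !add0r.
  right; split.
  - by exists (0, 0), 0; rewrite scale0r mul0r !addr0.
  - move=> u /FG Gu; exists u, 0; rewrite scale0r mul0r !addr0.
    by split=> //; case: u Gu.
  - move=> a _ _ [u [t [Gu ->]]] [v [s [Gv ->]]].
    exists (a *: u.1 + v.1, a * u.2 + v.2), (a * t + s); split; first exact: Glin.
    congr (_, _) => /=; last by ring.
    by rewrite scalerDr scalerDl scalerA addrACA.
  - move=> _ [u [t [Gu ->]]] /=.
    have Gs (a : R) : G (a *: u.1, a * u.2).
      by have := Glin a _ _ Gu G00; rewrite /= !addr0.
    (* Dividing by the absolute value of [t] turns domination on [G'] into [cl] for [t < 0] and into
       [cu] for [t > 0]. *)
    have [t0|t0|->] := ltgtP t 0; last by rewrite scale0r mul0r !addr0; exact: Gp.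
      have nt : 0 < - t by rewrite oppr_gt0.
      have := cl _ (Gs (- t)^-1) => /=.
      rewrite -(ler_pM2l nt) mulrBr mulrA mulfV ?lt0r_neq0// mul1r -(pZ _ _ (ltW nt)).
      rewrite scalerBr scalerA mulfV ?lt0r_neq0// scale1r scaleNr opprK; lra.
    have := cu _ (Gs t^-1) => /=.
    rewrite -(ler_pM2l t0) mulrBr mulrA mulfV ?lt0r_neq0// mul1r -(pZ _ _ (ltW t0)).
    rewrite scalerDr scalerA mulfV ?lt0r_neq0// scale1r; lra.
have [L GL] := choice Gtot.
have Guniq x r s : G (x, r) -> G (x, s) -> r = s.
  move=> Gr Gs.
  have h a b : G (x, a) -> G (x, b) -> a <= b.
    move=> Ga Gb; have := Gp _ (Glin (-1) _ _ Gb Ga).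
    by rewrite /= scaleN1r addNr p0; lra.
  by apply/eqP; rewrite eq_le !h.
exists L; split=> [a x y|x|u Fu].
- exact: Guniq (GL _) (Glin a _ _ (GL x) (GL y)).
- exact: Gp _ (GL x).
- by apply: Guniq (GL _) _; have := FG _ Fu; case: (u).
Qed.

(** * Graphs of partial embeddings *)

(* An isometric lattice homomorphism defined on a sublattice of V, with values
   in X, represented by its graph. *)
Record isograph (R : realType) (V X : banachLatticeType R) (G : set (V * X)) :
    Prop := IsIsograph {
  isograph0 : G (0, 0) ;
  isograph_lin : forall (a : R) u v, G u -> G v ->
    G (a *: u.1 + v.1, a *: u.2 + v.2) ;
  isograph_join : forall u v, G u -> G v -> G (vjoin u.1 v.1, vjoin u.2 v.2) ;
  isograph_norm : forall u, G u -> `|u.1| = `|u.2|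
}.

Section isograph_theory.
Context (R : realType) (V X : banachLatticeType R) (G : set (V * X)).
Hypothesis GG : isograph G.

Lemma isographZ (a : R) u : G u -> G (a *: u.1, a *: u.2).
Proof.
by move=> Gu; have := isograph_lin GG a Gu (isograph0 GG); rewrite /= !addr0.
Qed.

Lemma isographN u : G u -> G (- u.1, - u.2).
Proof. by move=> /(isographZ (-1)); rewrite !scaleN1r. Qed.

Lemma isographD u v : G u -> G v -> G (u.1 + v.1, u.2 + v.2).
Proof. by move=> Gu /(isograph_lin GG 1 Gu); rewrite !scale1r. Qed.

Lemma isographB u v : G u -> G v -> G (u.1 - v.1, u.2 - v.2).
Proof. by move=> Gu /isographN; exact: isographD. Qed.

Lemma isograph_dist u v : G u -> G v -> `|u.1 - v.1| = `|u.2 - v.2|.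
Proof. by move=> Gu /(isographB Gu) /(isograph_norm GG). Qed.

Lemma isograph_fun u v : G u -> G v -> u.1 = v.1 -> u.2 = v.2.
Proof.
move=> Gu Gv uv; apply/eqP; rewrite -subr_eq0 -normr_eq0.
by rewrite -(isograph_dist Gu Gv) uv subrr normr0.
Qed.

Lemma isograph_pos u : G u -> G (vpos u.1, vpos u.2).
Proof. by move=> Gu; exact: (isograph_join GG Gu (isograph0 GG)). Qed.

Lemma isograph_vabs u : G u -> G (vabs u.1, vabs u.2).
Proof. by move=> Gu; exact: (isograph_join GG Gu (isographN Gu)). Qed.

Definition isograph_closure : set (V * X) :=
  [set u | forall e : R, 0 < e ->
    exists v, [/\ G v, `|u.1 - v.1| <= e & `|u.2 - v.2| <= e]].

Lemma isograph_closure_sub : G `<=` isograph_closure.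
Proof. by move=> u Gu e e0; exists u; rewrite !subrr !normr0 !ltW. Qed.

(** Joins pass to the limit by the Lipschitz estimate [norm_vjoinB]. Consequently a maximal graph
    contains its closure. *)
Lemma isograph_closureP : isograph isograph_closure.
Proof.
have lin_dist (W : banachLatticeType R) (a : R) (x x' y y' : W) (e : R) :
    0 < e -> `|x - x'| <= e / (2 * (`|a| + 1)) -> `|y - y'| <= e / 2 ->
    `|a *: x + y - (a *: x' + y')| <= e.
  move=> e0 xx yy; rewrite opprD addrACA -scalerBr.
  apply: le_trans (ler_normD _ _) _; rewrite normrZ.
  suff : `|a| * `|x - x'| <= e / 2 by lra.
  have a1 : 0 < `|a| + 1 by rewrite ltr_wpDl.
  apply: (@le_trans _ _ ((`|a| + 1) * (e / (2 * (`|a| + 1))))).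
    by apply: ler_pM => //; rewrite lerDl.
  by rewrite le_eqVlt; apply/orP; left; apply/eqP; field; rewrite lt0r_neq0.
split.
- exact: isograph_closure_sub (isograph0 GG).
- move=> a u v uc vc e e0.
  have a1 : 0 < `|a| + 1 by rewrite ltr_wpDl.
  have /uc[u' [Gu' u1 u2]] : 0 < e / (2 * (`|a| + 1)) by rewrite divr_gt0// mulr_gt0.
  have /vc[v' [Gv' v1 v2]] : 0 < e / 2 by rewrite divr_gt0.
  exists (a *: u'.1 + v'.1, a *: u'.2 + v'.2); split => /=; try exact: lin_dist.
  exact: isograph_lin.
- move=> u v uc vc e e0; have e2 : 0 < e / 2 by rewrite divr_gt0.
  have [u' [Gu' u1 u2]] := uc _ e2; have [v' [Gv' v1 v2]] := vc _ e2.
  exists (vjoin u'.1 v'.1, vjoin u'.2 v'.2); split=> /=.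
  + exact: isograph_join.
  + by apply: le_trans (norm_vjoinB _ _ _ _) _; lra.
  + by apply: le_trans (norm_vjoinB _ _ _ _) _; lra.
- move=> u uc; apply/eqP; rewrite -subr_eq0 -normr_le0.
  apply/ler_addgt0Pr => e e0; rewrite add0r.
  have e2 : 0 < e / 2 by rewrite divr_gt0.
  have [v [Gv v1 v2]] := uc _ e2.
  have n1 := ler_dist_dist u.1 v.1; have n2 := ler_dist_dist v.2 u.2.
  rewrite distrC in v2; rewrite (isograph_norm GG Gv) in n1.
  apply: le_trans (ler_distD `|v.2| _ _) _; lra.
Qed.

End isograph_theory.

(** The second clause says that gluing [x] on the band to [y] off it commutes with joins.
    Multiplication by an indicator has this property; multiplication by a general density does
    not. *)
Definition band_proj (R : realType) (V : banachLatticeType R) (P : V -> V) :=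
  (forall (a : R) x y, P (a *: x + y) = a *: P x + P y) /\
  (forall x y x' y', vjoin (P x + (y - P y)) (P x' + (y' - P y')) =
     P (vjoin x x') + (vjoin y y' - P (vjoin y y'))).

Section band_proj_theory.
Context (R : realType) (V : banachLatticeType R) (P : V -> V).
Hypothesis BP : band_proj P.

Lemma band_projD x y : P (x + y) = P x + P y.
Proof. by rewrite -{1}(scale1r x) BP.1 scale1r. Qed.

Lemma band_proj0 : P 0 = 0.
Proof. by apply: (addrI (P 0)); rewrite -band_projD !addr0. Qed.

Lemma band_projZ (a : R) x : P (a *: x) = a *: P x.
Proof. by rewrite -[a *: x]addr0 BP.1 band_proj0 addr0. Qed.

Lemma band_projN x : P (- x) = - P x.
Proof. by rewrite -scaleN1r band_projZ scaleN1r. Qed.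

Lemma vabs_band_proj x y :
  vabs (P x + (y - P y)) = P (vabs x) + (vabs y - P (vabs y)).
Proof. by rewrite /vabs -BP.2 !band_projN !opprD !opprK. Qed.

Lemma norm_band_proj (AL : AL_space V) x y :
  `|P x + (y - P y)| = aint (P (vabs x)) + (`|y| - aint (P (vabs y))).
Proof.
by rewrite -aint_vabs// vabs_band_proj aintD// aintB// aint_vabs.
Qed.

End band_proj_theory.

(** By [norm_band_proj], the norm of a glued element depends only on the norm of [v] and on the
    integrals of the projections of the absolute values of [u] and [v]. Graphs are stable under
    absolute values, so equality of integrals on [G] makes the gluing isometric. *)
Lemma isograph_mult (R : realType) (V X : banachLatticeType R)
    (G : set (V * X)) (P : V -> V) (Q : X -> X) :
  AL_space V -> AL_space X -> isograph G -> band_proj P -> band_proj Q ->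
  (forall u, G u -> aint (P u.1) = aint (Q u.2)) ->
  isograph [set (P u.1 + (v.1 - P v.1), Q u.2 + (v.2 - Q v.2)) | u in G & v in G].
Proof.
move=> ALV ALX GG BP BQ PQ; split.
- exists (0, 0); first exact: isograph0.
  exists (0, 0); first exact: isograph0.
  by rewrite /= (band_proj0 BP) (band_proj0 BQ) !subr0 !addr0.
- move=> a _ _ [u Gu [v Gv <-]] [u' Gu' [v' Gv' <-]] /=.
  exists (a *: u.1 + u'.1, a *: u.2 + u'.2); first exact: isograph_lin.
  exists (a *: v.1 + v'.1, a *: v.2 + v'.2); first exact: isograph_lin.
  have e (W : banachLatticeType R) (S : W -> W) (x x' y y' : W) : band_proj S ->
      S (a *: x + x') + (a *: y + y' - S (a *: y + y')) =
      a *: (S x + (y - S y)) + (S x' + (y' - S y')).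
    move=> BS; rewrite !BS.1 scalerDr scalerBr [RHS]addrACA; congr (_ + _).
    by rewrite opprD addrACA.
  by rewrite /= !e.
- move=> _ _ [u Gu [v Gv <-]] [u' Gu' [v' Gv' <-]] /=.
  exists (vjoin u.1 u'.1, vjoin u.2 u'.2); first exact: isograph_join.
  exists (vjoin v.1 v'.1, vjoin v.2 v'.2); first exact: isograph_join.
  by rewrite /= BP.2 BQ.2.
- move=> _ [u Gu [v Gv <-]] /=; rewrite !norm_band_proj//.
  by rewrite (PQ _ (isograph_vabs GG Gu)) (PQ _ (isograph_vabs GG Gv))
    (isograph_norm GG Gv).
Qed.

(** [w] and [z] are disjoint from everything in [G], so on both sides joins are computed separately,
    and the norm of [a + t w] is the norm of [a] plus [|t|] times that of [w]. Equal norms of [w]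
    and [z] then give isometry. *)
Lemma isograph_disj (R : realType) (V X : banachLatticeType R)
    (G : set (V * X)) (P : V -> V) (Q : X -> X) w z :
  AL_space V -> AL_space X -> isograph G -> band_proj P -> band_proj Q ->
  (forall u, G u -> P u.1 = 0 /\ Q u.2 = 0) ->
  vle 0 w -> vle 0 z -> P w = w -> Q z = z -> `|w| = `|z| ->
  isograph [set (u.1 + t *: w, u.2 + t *: z) | u in G & t in [set: R]].
Proof.
move=> ALV ALX GG BP BQ PQ0 w0 z0 Pw Qz wz.
have max_scale (W : banachLatticeType R) (x : W) (t s : R) : vle 0 x ->
    vjoin (t *: x) (s *: x) = Num.max t s *: x.
  move=> x0; case: (leP t s) => ts.
    apply: vjoin_r; apply/vle_sub; rewrite -scalerBl.
    by apply: vscale_ge0; rewrite ?subr_ge0.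
  apply: vjoin_l; apply/vle_sub; rewrite -scalerBl.
  by apply: vscale_ge0; rewrite ?subr_ge0// ltW.
have joinE (W : banachLatticeType R) (S : W -> W) (x y a b : W) (t s : R) :
    band_proj S -> vle 0 x -> S x = x -> S a = 0 -> S b = 0 ->
    S (vjoin a b) = 0 ->
    vjoin (a + t *: x) (b + s *: x) = vjoin a b + Num.max t s *: x.
  (* With [t *: x] in the band and [a] off it, the glued element is simply their sum. *)
  move=> BS x0 Sx Sa Sb Sab; have := BS.2 (t *: x) a (s *: x) b.
  rewrite max_scale// !(band_projZ BS) Sx Sa Sb Sab !subr0.
  by rewrite ![_ *: x + _]addrC.
split.
- exists (0, 0); first exact: isograph0.
  by exists 0; rewrite //= !scale0r !addr0.
- move=> a _ _ [u Gu [t _ <-]] [v Gv [s _ <-]] /=.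
  exists (a *: u.1 + v.1, a *: u.2 + v.2); first exact: isograph_lin.
  by exists (a * t + s); rewrite //= !scalerDl !scalerDr !scalerA !(addrACA _ v.1)
    (addrACA (a *: u.1)) (addrACA (a *: u.2)).
- move=> _ _ [u Gu [t _ <-]] [v Gv [s _ <-]] /=.
  have Guv := isograph_join GG Gu Gv.
  exists (vjoin u.1 v.1, vjoin u.2 v.2) => //; exists (Num.max t s) => //=.
  have [[Pu Qu] [Pv Qv] [/= Puv Quv]] := And3 (PQ0 _ Gu) (PQ0 _ Gv) (PQ0 _ Guv).
  by rewrite (joinE _ P)// (joinE _ Q).
- move=> _ [u Gu [t _ <-]] /=.
  have GuN := isographN GG Gu; have Guv := isograph_vabs GG Gu.
  have [[Pu Qu] [/= Pv Qv] [/= Puv Quv]] :=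
    And3 (PQ0 _ Gu) (PQ0 _ GuN) (PQ0 _ Guv).
  have normE (W : banachLatticeType R) (S : W -> W) (x a : W) : AL_space W ->
      band_proj S -> vle 0 x -> S x = x -> S a = 0 -> S (vabs a) = 0 ->
      `|a + t *: x| = `|a| + `|t| * `|x|.
    move=> ALW BS x0 Sx Sa Saa; rewrite -norm_vabs /vabs opprD -scaleNr.
    rewrite (joinE _ S)// ?(band_projN BS) ?Sa ?oppr0// ALW; last first.
    - by apply: vscale_ge0 => //; rewrite le_max oppr_ge0 le_total.
    - exact: vabs_ge0.
    by rewrite -/(vabs a) norm_vabs normrZ ger0_norm ?le_max ?oppr_ge0 ?le_total// maxrN.
  by rewrite (normE _ P)// (normE _ Q)// wz (isograph_norm GG Gu).
Qed.

Section extension_sub.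
Context (R : realType) (V X : banachLatticeType R) (G : set (V * X)).
Hypothesis GG : isograph G.

Lemma isograph_mult_sub (P : V -> V) (Q : X -> X) :
  G `<=` [set (P u.1 + (v.1 - P v.1), Q u.2 + (v.2 - Q v.2)) | u in G & v in G].
Proof.
move=> u Gu; exists u => //; exists u => //.
by rewrite [P _ + _]addrC subrK [Q _ + _]addrC subrK; case: (u).
Qed.

Lemma isograph_mult_at (P : V -> V) (Q : X -> X) u :
  band_proj P -> band_proj Q -> G u ->
  [set (P u.1 + (v.1 - P v.1), Q u.2 + (v.2 - Q v.2)) | u in G & v in G]
    (P u.1, Q u.2).
Proof.
move=> BP BQ Gu; exists u => //; exists (0, 0); first exact: isograph0.
by rewrite /= (band_proj0 BP) (band_proj0 BQ) !subr0 !addr0.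
Qed.

Lemma isograph_disj_sub w z :
  G `<=` [set (u.1 + t *: w, u.2 + t *: z) | u in G & t in [set: R]].
Proof.
by move=> u Gu; exists u => //; exists 0 => //; rewrite !scale0r !addr0; case: (u).
Qed.

Lemma isograph_disj_at w z :
  [set (u.1 + t *: w, u.2 + t *: z) | u in G & t in [set: R]] (w, z).
Proof.
exists (0, 0); first exact: isograph0.
by exists 1 => //; rewrite !scale1r !add0r.
Qed.

End extension_sub.

(** * Multiplication operators on L_1 *)

Lemma measurable_lt_set d (T : measurableType d) (R : realType) (f g : T -> R) :
  measurable_fun setT f -> measurable_fun setT g -> measurable [set t | f t < g t].
Proof.
move=> mf mg; have := measurable_funB mg mf measurableT (measurable_itv `]0, +oo[).
rewrite setTI; congr measurable; apply/seteqP.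
by split=> t; rewrite /= in_itv /= andbT subr_gt0.
Qed.

Section L1_operations.
Context d (T : measurableType d) (R : realType).
Variable mu : {measure set T -> \bar R}.
Implicit Types x y : L1 mu.

Lemma L1_ext x y : {ae mu, forall t, L1_fun x t = L1_fun y t} -> x = y.
Proof.
move=> xy; rewrite -(L1_funK x) -(L1_funK y); apply/toL1_eqP.
by apply: filterS xy => t e _.
Qed.

Lemma toL1E (f : LfunType mu (@lexx _ _ 1%E)) :
  {ae mu, forall t, L1_fun (toL1 f) t = f t}.
Proof. by apply: filterS (toL1K f) => t; apply. Qed.

Lemma L1_funD x y : {ae mu, forall t, L1_fun (x + y) t = L1_fun x t + L1_fun y t}.
Proof.
suff -> : x + y = toL1 (L1_fun x + L1_fun y) by exact: toL1E.
by rewrite toL1D !L1_funK.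
Qed.

Lemma L1_funZ (a : R) x : {ae mu, forall t, L1_fun (a *: x) t = a * L1_fun x t}.
Proof.
suff -> : a *: x = toL1 (a *: L1_fun x) by exact: toL1E.
by rewrite toL1Z L1_funK.
Qed.

Lemma L1_funN x : {ae mu, forall t, L1_fun (- x) t = - L1_fun x t}.
Proof.
suff -> : - x = toL1 (- L1_fun x) by exact: toL1E.
by rewrite toL1N L1_funK.
Qed.

Lemma L1_funB x y : {ae mu, forall t, L1_fun (x - y) t = L1_fun x t - L1_fun y t}.
Proof. by apply: filterS2 (L1_funD x (- y)) (L1_funN y) => t -> ->. Qed.

Lemma L1_fun0 : {ae mu, forall t, L1_fun (0 : L1 mu) t = 0}.
Proof. exact: toL1E. Qed.

Lemma L1_fun_join x y :
  {ae mu, forall t, L1_fun (vjoin x y) t = Num.max (L1_fun x t) (L1_fun y t)}.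
Proof. exact: toL1E. Qed.

Lemma L1_fun_meet x y :
  {ae mu, forall t, L1_fun (vmeet x y) t = Num.min (L1_fun x t) (L1_fun y t)}.
Proof. exact: toL1E. Qed.

Lemma L1_norm_int x : (`|x|%:E = \int[mu]_t `|L1_fun x t|%:E)%E.
Proof. by rewrite -normL1E L1_funK. Qed.

Lemma measurable_L1_fun x : measurable_fun setT (L1_fun x : T -> R).
Proof. exact: LF_measurable. Qed.

Lemma L1_vleP x y : vle x y <-> {ae mu, forall t, L1_fun x t <= L1_fun y t}.
Proof. by []. Qed.

Lemma L1_ge0P x : vle 0 x <-> {ae mu, forall t, 0 <= L1_fun x t}.
Proof.
split=> [/L1_vleP|h]; first by apply: filterS2 L1_fun0 => t ->.
by apply/L1_vleP; apply: filterS2 L1_fun0 h => t ->.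
Qed.

Lemma L1_AL : AL_space (L1 mu).
Proof.
move=> x y /L1_ge0P x0 /L1_ge0P y0.
have mx (z : L1 mu) : measurable_fun setT (fun t => `|L1_fun z t|%:E).
  by apply/measurable_EFinP/measurableT_comp => //; exact: measurable_L1_fun.
apply: EFin_inj; rewrite EFinD !L1_norm_int -ge0_integralD//.
apply: ae_eq_integral => //; first exact: emeasurable_funD.
apply: filterS3 x0 y0 (L1_funD x y) => t x0 y0 -> _.
by rewrite -EFinD !ger0_norm// addr_ge0.
Qed.

(** Multipliers are genuine functions, bounded at every point, so that the set where a coordinate
    lies below [k] can be formed without choosing representatives. *)
Definition umult := {k : T -> R |
  measurable_fun setT k /\ forall t, 0 <= k t <= 1}.

Lemma umult_ge0 (k : umult) t : 0 <= sval k t.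
Proof. by case: k => k [mk /= /(_ t)/andP[]]. Qed.

Lemma umult_le1 (k : umult) t : sval k t <= 1.
Proof. by case: k => k [mk /= /(_ t)/andP[]]. Qed.

Lemma measurable_umult (k : umult) : measurable_fun setT (sval k).
Proof. by case: k => k []. Qed.

Lemma umult_Lfun (k : umult) x : (fun t => sval k t * L1_fun x t) \in Lfun mu 1.
Proof.
apply/Lfun1_integrable.
have /Lfun1_integrable ix := LfunP (L1_fun x).
apply: integrableMr ix => //; first exact: measurable_umult.
exists 1; split=> // M M1 t _ /=.
by rewrite ger0_norm ?umult_ge0// (le_trans (umult_le1 _ _))// ltW.
Qed.

Definition umul (k : umult) x : L1 mu := toL1 (Lfun_Sub _ (umult_Lfun k x)).

Lemma umulE k x : {ae mu, forall t, L1_fun (umul k x) t = sval k t * L1_fun x t}.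
Proof. exact: toL1E. Qed.

Lemma umul_lin k (a : R) x y : umul k (a *: x + y) = a *: umul k x + umul k y.
Proof.
apply: L1_ext; near=> t.
rewrite (near (umulE _ _) t)// (near (L1_funD _ _) t)// (near (L1_funZ _ _) t)//.
rewrite (near (L1_funD _ _) t)// (near (L1_funZ _ _) t)// !(near (umulE _ _) t)//.
by rewrite mulrDr mulrCA.
Unshelve. all: by end_near. Qed.

Lemma umulB k x y : umul k (x - y) = umul k x - umul k y.
Proof.
by rewrite -scaleN1r addrC umul_lin scaleN1r addrC.
Qed.

Lemma umul0 k : umul k 0 = 0.
Proof. by rewrite -(subrr 0) umulB !subrr. Qed.

Lemma umulD k x y : umul k (x + y) = umul k x + umul k y.
Proof. by rewrite -[x]scale1r umul_lin !scale1r. Qed.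

Lemma umulC k k' x : umul k (umul k' x) = umul k' (umul k x).
Proof.
apply: L1_ext; near=> t; rewrite !(near (umulE _ _) t)//.
by rewrite mulrCA.
Unshelve. all: by end_near. Qed.

Lemma umul_ge0 k x : vle 0 x -> vle 0 (umul k x).
Proof.
move=> /L1_ge0P x0; apply/L1_ge0P; apply: filterS2 x0 (umulE k x) => t x0 ->.
by rewrite mulr_ge0// umult_ge0.
Qed.

Lemma umul_le k x : vle 0 x -> vle (umul k x) x.
Proof.
move=> /L1_ge0P x0; apply/L1_vleP; apply: filterS2 x0 (umulE k x) => t x0 ->.
by rewrite ler_piMl// umult_le1.
Qed.

Lemma norm_umul k x : `|umul k x| <= `|x|.
Proof.
rewrite -lee_fin !L1_norm_int; apply: ae_ge0_le_integral => //.
- by apply/measurable_EFinP/measurableT_comp => //; exact: measurable_L1_fun.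
- by apply/measurable_EFinP/measurableT_comp => //; exact: measurable_L1_fun.
- apply: filterS (umulE k x) => t -> _; rewrite lee_fin normrM.
  by rewrite ler_piMl// ger0_norm ?umult_le1// umult_ge0.
Qed.

Lemma indic_umult (A : set T) : measurable_fun setT
  ((if pselect (measurable A) then \1_A else cst 0) : T -> R) /\
  forall t, 0 <= ((if pselect (measurable A) then \1_A else cst 0) : T -> R) t <= 1.
Proof.
case: pselect => mA /=; split=> //; last by move=> t; rewrite /cst lexx ler01.
by move=> t; rewrite /indic; case: (t \in A); rewrite ?lexx ?ler01.
Qed.

(* Multiplication by 0 when A is not measurable. *)
Definition uind (A : set T) : umult := exist _ _ (indic_umult A).

Lemma uindE A : measurable A -> sval (uind A) = \1_A.
Proof. by rewrite /uind /=; case: pselect. Qed.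

Lemma uind01 A t : (sval (uind A) t == 0) || (sval (uind A) t == 1).
Proof.
rewrite /uind /=; case: pselect => mA /=; last by rewrite eqxx.
by rewrite /indic; case: (t \in A); rewrite eqxx ?orbT.
Qed.

Lemma uindK A x : umul (uind A) (umul (uind A) x) = umul (uind A) x.
Proof.
apply: L1_ext; near=> t; rewrite !(near (umulE _ _) t)//.
by have /orP[/eqP->|/eqP->] := uind01 A t; rewrite ?mul0r// !mul1r.
Unshelve. all: by end_near. Qed.

Lemma band_proj_umul A : band_proj (umul (uind A)).
Proof.
split=> [|x y x' y']; first exact: umul_lin.
apply: L1_ext; near=> t.
rewrite (near (L1_fun_join _ _) t)// !(near (L1_funD _ _) t)// !(near (L1_funN _) t)//.
rewrite !(near (umulE _ _) t)// !(near (L1_fun_join _ _) t)//.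
by have /orP[/eqP->|/eqP->] := uind01 A t;
  rewrite ?mul0r ?mul1r ?subr0 ?add0r ?subrr ?addr0.
Unshelve. all: by end_near. Qed.

End L1_operations.

(** * L_1 of a finite measure: simple functions and densities of functionals *)

Definition mk_finite_measure d (T : measurableType d) (R : realType)
    (m : set T -> \bar R) (m0 : m set0 = 0%E) (m_ge0 : forall A, (0 <= m A)%E)
    (m_sadd : semi_sigma_additive m) (m_fin : fin_num_fun m) :
    {finite_measure set T -> \bar R} :=
  let m1 : {measure set T -> \bar R} :=
    HB.pack m (isMeasure.Build _ _ _ m m0 m_ge0 m_sadd) in
  HB.pack (Measure.sort m1) (Measure_isFinite.Build _ _ _ (Measure.sort m1) m_fin).

Section L1_finite_measure.
Context d (T : measurableType d) (R : realType).
Variable mu : {measure set T -> \bar R}.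
Hypothesis mu_fin : fin_num_fun mu.

Lemma Lfun1_one : (fun _ : T => 1 : R) \in Lfun mu 1.
Proof.
apply/Lfun1_integrable/measurable_bounded_integrable => //.
  by rewrite ltey_eq mu_fin.
by exists 1; split=> // M M1 t _; rewrite normr1 ltW.
Qed.

Definition L1_one : L1 mu := toL1 (Lfun_Sub _ Lfun1_one).

Lemma L1_oneE : {ae mu, forall t, L1_fun L1_one t = 1}.
Proof. exact: toL1E. Qed.

Definition L1_indic (A : set T) : L1 mu := umul (uind R A) L1_one.

Lemma L1_indicE A : measurable A ->
  {ae mu, forall t, L1_fun (L1_indic A) t = \1_A t}.
Proof.
move=> mA; apply: filterS2 (umulE (uind R A) L1_one) L1_oneE => t -> ->.
by rewrite uindE// mulr1.
Qed.

Lemma norm_L1_indic A : measurable A -> (`|L1_indic A|%:E = mu A)%E.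
Proof.
move=> mA; rewrite L1_norm_int -[in RHS](setIT A) -integral_indic//.
apply: ae_eq_integral => //.
- by apply/measurable_EFinP/measurableT_comp => //; exact: measurable_L1_fun.
- exact/measurable_EFinP.
- by apply: filterS (L1_indicE mA) => t -> _; rewrite ger0_norm.
Qed.

Lemma L1_indic_ge0 A : vle 0 (L1_indic A).
Proof.
apply: umul_ge0; apply/L1_ge0P.
by apply: filterS L1_oneE => t ->; exact: ler01.
Qed.

Lemma L1_fun_simple (s : seq R) (A : R -> set T) : (forall r, measurable (A r)) ->
  {ae mu, forall t, L1_fun (\sum_(r <- s) r *: L1_indic (A r)) t =
    \sum_(r <- s) r * \1_(A r) t}.
Proof.
move=> mA; elim: s => [|r s ih].
  by rewrite big_nil; apply: filterS (L1_fun0 mu) => t ->; rewrite big_nil.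
rewrite big_cons; near=> t.
rewrite (near (L1_funD _ _) t)// (near (L1_funZ _ _) t)// big_cons.
by rewrite (near (L1_indicE (mA r)) t)// (near ih t).
Unshelve. all: by end_near. Qed.

Import HBSimple.

(** [C] collects the level sets of a sequence of simple functions converging to [x] in norm, each
    with finitely many values. In this form an identity linear in [x] can be checked on countably
    many sets, which later keeps the exceptional coordinates countable. *)
Lemma L1_simple_dense (x : L1 mu) : exists C : set (set T),
  [/\ countable C, forall A, C A -> measurable A &
   forall (phi : L1 mu -> R) (M : R),
     (forall a y z, phi (a *: y + z) = a * phi y + phi z) ->
     (forall y, `|phi y| <= M * `|y|) ->
     (forall A, C A -> phi (L1_indic A) = 0) -> phi x = 0].
Proof.
have /Lfun1_integrable ix := LfunP (L1_fun x).
have [g [ig _ gx]] := approximation_sfun_integrable measurableT ix.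
pose C n := [set g n @^-1` [set r] | r in range (g n)].
exists (\bigcup_n C n); split.
- apply: bigcup_countable => // n _; apply: finite_set_countable.
  exact: finite_image.
- by move=> _ [n _ [r _ <-]]; exact: measurable_funPTI.
move=> phi M phi_lin phi_bd phi0.
have phi00 : phi 0 = 0.
  by have := phi_lin (-1) 0 0; rewrite scaler0 addr0; lra.
pose y n := \sum_(r <- fset_set (range (g n))) r *: L1_indic (g n @^-1` [set r]).
have phiy n : phi (y n) = 0.
  rewrite /y big_seq_cond.
  apply: (big_ind (fun z => phi z = 0)) => //.
    by move=> z1 z2 h1 h2; rewrite -[z1]scale1r phi_lin h1 h2 mulr0 addr0.
  move=> r; rewrite andbT in_fset_set// inE => gr.
  rewrite -[_ *: _]addr0 phi_lin phi00 addr0 phi0 ?mulr0//.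
  by exists n => //; exists r.
have yx n : (`|x - y n|%:E = \int[mu]_z `|(EFin \o L1_fun x) z - (g n z)%:E|)%E.
  rewrite L1_norm_int; apply: ae_eq_integral => //.
  - by apply/measurable_EFinP/measurableT_comp => //; exact: measurable_L1_fun.
  - apply: measurableT_comp => //; apply: emeasurable_funB.
      by apply/measurable_EFinP; exact: measurable_L1_fun.
    exact/measurable_EFinP.
  - have := @L1_fun_simple (fset_set (range (g n))) (fun r => g n @^-1` [set r]).
    move=> /(_ (fun r => measurable_funPTI _ (measurable_set1 r))).
    apply: filterS2 (L1_funB x (y n)) => t -> -> _ /=.
    by rewrite [g n t]fimfunE fsbig_finite.
have : (fun n => `|x - y n|%:E)%E @ \oo --> 0%:E.
  by under eq_fun do rewrite yx.
move=> /fine_cvgP[_ /cvgrPdist_lt yx0].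
apply: (functional_eq0 phi_lin phi_bd) => e /yx0[n _ /(_ n (leqnn n))] /=.
by rewrite sub0r normrN normr_id => xn; exists (y n).
Qed.

Lemma L1_indicU A B : measurable A -> measurable B -> A `&` B = set0 ->
  L1_indic (A `|` B) = L1_indic A + L1_indic B.
Proof.
move=> mA mB AB; have mAB := measurableU _ _ mA mB; apply: L1_ext; near=> t.
rewrite (near (L1_funD _ _) t)// (near (L1_indicE mA) t)// (near (L1_indicE mB) t)//.
rewrite (near (L1_indicE mAB) t)// !indicE in_setU.
case: (boolP (t \in A)) => tA; case: (boolP (t \in B)) => tB; rewrite ?addr0 ?add0r//.
exfalso; move: tA tB; rewrite !inE => tA tB.
by have : (A `&` B) t by []; rewrite AB.
Unshelve. all: by end_near. Qed.

Lemma L1_indic0 : L1_indic set0 = 0.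
Proof. by apply/eqP; rewrite -normr_eq0 -eqe norm_L1_indic// measure0. Qed.

(** The norm of the difference is the difference of the norms, by additivity on positive elements,
    so countable additivity of [mu] suffices. It makes the set function induced by a bounded
    functional countably additive. *)
Lemma L1_indic_bigcup (F : nat -> set T) : (forall i, measurable (F i)) ->
  trivIset setT F ->
  `|L1_indic (\bigcup_i F i) - \sum_(0 <= i < n) L1_indic (F i)| @[n --> \oo] --> 0.
Proof.
move=> mF tF; pose U := \bigcup_i F i; pose V n := \big[setU/set0]_(i < n) F i.
have mU : measurable U by exact: bigcupT_measurable.
have mV n : measurable (V n) by exact: bigsetU_measurable.
have VU n : V n `<=` U.
  by rewrite /V -bigcup_mkord => t [i _ Ft]; exists i.
have VE n : \sum_(0 <= i < n) L1_indic (F i) = L1_indic (V n).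
  elim: n => [|n ih]; first by rewrite big_geq// /V big_ord0 L1_indic0.
  rewrite big_nat_recr//= ih /V big_ord_recr /= L1_indicU//; first exact: (mV n).
  by apply: (@trivIset_bigsetUI _ xpredT) => //; exact: sub_trivIset tF.
have UV n : L1_indic U = L1_indic (V n) + L1_indic (U `\` V n).
  rewrite -L1_indicU//; first by rewrite setDUK.
    exact: measurableD.
  by rewrite setDE setICA setICr setI0.
have normE n : `|L1_indic U - \sum_(0 <= i < n) L1_indic (F i)| =
    `|L1_indic U| - \sum_(0 <= i < n) `|L1_indic (F i)|.
  have -> : \sum_(0 <= i < n) `|L1_indic (F i)| = `|L1_indic (V n)|.
    rewrite -VE; elim: n => [|n ih]; first by rewrite !big_geq// normr0.
    rewrite !big_nat_recr//= ih L1_AL//; last exact: L1_indic_ge0.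
    by rewrite VE; exact: L1_indic_ge0.
  rewrite VE (UV n) addrC addKr L1_AL; [|exact: L1_indic_ge0..].
  by rewrite addrC addKr.
rewrite -/U (funext normE) -[X in _ --> X](subrr `|L1_indic U|); apply: cvgB; first exact: cvg_cst.
have : (\sum_(0 <= i < n) `|L1_indic (F i)|)%:E @[n --> \oo] --> `|L1_indic U|%:E.
  rewrite norm_L1_indic//; under eq_fun do rewrite -sumEFin.
  under eq_fun do under eq_bigr do rewrite norm_L1_indic//.
  exact: measure_semi_sigma_additive.
by move=> /fine_cvgP[].
Qed.

(* Radon-Nikodym for the measure that phi induces on indicator functions. *)
Lemma L1_functional_density (phi : L1 mu -> R) :
  (forall a y z, phi (a *: y + z) = a * phi y + phi z) ->
  (forall y, phi y <= `|vpos y|) ->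
  exists k : umult T R, forall x, phi x = aint (umul k x).
Proof.
move=> phi_lin phi_le.
have phi00 : phi 0 = 0.
  by have := phi_lin (-1) 0 0; rewrite scaler0 addr0; lra.
have phiN x : phi (- x) = - phi x.
  by rewrite -[- x]addr0 -scaleN1r phi_lin phi00; lra.
have phiD x y : phi (x + y) = phi x + phi y.
  by rewrite -[x]scale1r phi_lin mul1r scale1r.
(* Domination is applied to [- x], whose positive part is 0; a bound by the norm alone would not
   give positivity. *)
have phi_ge0 x : vle 0 x -> 0 <= phi x.
  move=> x0; have := phi_le (- x); rewrite phiN vpos_eq0 ?normr0 ?oppr_le0//.
  by rewrite -[X in vle _ X]oppr0; exact: vleN.
have phi_bd x : `|phi x| <= `|x|.
  rewrite ler_norml lerNl -phiN -{1}normrN.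
  by rewrite !(le_trans (phi_le _))// norm_vpos_le.
pose nu A := if pselect (measurable A) then (phi (L1_indic A))%:E else 0%E.
have nuE A : measurable A -> nu A = (phi (L1_indic A))%:E.
  by rewrite /nu; case: pselect.
have nu0 : nu set0 = 0%E.
  rewrite nuE//; suff -> : L1_indic set0 = 0 by rewrite phi00.
  by apply/eqP; rewrite -normr_eq0 -eqe norm_L1_indic// measure0.
have nu_ge0 A : (0 <= nu A)%E.
  rewrite /nu; case: pselect => // mA; rewrite lee_fin; apply: phi_ge0.
  exact: L1_indic_ge0.
have nusa : semi_sigma_additive nu.
  move=> F mF tF mU; rewrite nuE//.
  have -> : (fun n => \sum_(0 <= i < n) nu (F i))%E =
      EFin \o (fun n => \sum_(0 <= i < n) phi (L1_indic (F i))).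
    by apply/funext => n /=; rewrite -sumEFin; apply: eq_bigr => i _; rewrite nuE.
  apply: cvg_EFin; first exact: nearW.
  apply/cvgrPdist_le => e e0.
  have /cvgrPdist_le/(_ _ e0) := L1_indic_bigcup mF tF.
  apply: filterS => n; rewrite sub0r normrN normr_id; apply: le_trans.
  apply: le_trans (phi_bd _); rewrite le_eqVlt; apply/orP; left; apply/eqP.
  congr `|_|; rewrite phiD phiN; congr (_ - _).
  by rewrite /= (big_morph phi phiD phi00).
have nufin : fin_num_fun nu by move=> A mA; rewrite nuE.
pose nuM := mk_finite_measure nu0 nu_ge0 nusa nufin.
pose muM := mk_finite_measure (measure0 mu) (measure_ge0 mu)
  (@measure_semi_sigma_additive _ _ _ mu) mu_fin.
have nu_mu : nuM `<< muM.
  apply/null_content_dominatesP => A mA A0; rewrite /nuM/= nuE//.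
  apply/eqP; rewrite eqe -normr_le0; apply: le_trans (phi_bd _) _.
  by rewrite -lee_fin norm_L1_indic// -[X in (X <= _)%E]/(muM A) A0.
have [f [f0 intf nuf]] := radon_nikodym_finite nu_mu.
have mf : measurable_fun setT f by exact: measurable_int intf.
have ff : {ae mu, forall t, f t \is a fin_num}.
  by have := integrable_ae measurableT intf; apply: filterS => t; apply.
have fL : (fun t => fine (f t)) \in Lfun mu 1.
  apply/Lfun1_integrable; apply/integrableP; split.
    by apply/measurable_EFinP; exact: measurableT_comp.
  move/integrableP : intf => [_]; apply: le_lt_trans.
  apply: ae_ge0_le_integral => //.
  - by apply: measurableT_comp => //; apply/measurable_EFinP; exact: measurableT_comp.
  - exact: measurableT_comp.
  - by apply: filterS ff => t ft _; rewrite -[X in (_ <= `|X|)%E](fineK ft).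
pose F : L1 mu := toL1 (Lfun_Sub _ fL).
have F0 : vle 0 F.
  apply/L1_ge0P; apply: filterS (toL1E (Lfun_Sub _ fL)) => t -> /=.
  exact: fine_ge0.
have phiF A : measurable A -> phi (L1_indic A) = aint (umul (uind R A) F).
  move=> mA; rewrite aint_ge0E; last exact: umul_ge0.
  apply: EFin_inj; rewrite -nuE// L1_norm_int -[LHS]/(nuM A) nuf// (integral_mkcond A).
  apply: ae_eq_integral => //.
  - by apply/(measurable_restrictT _ _).1 => //; exact: measurable_funTS.
  - by apply/measurable_EFinP/measurableT_comp => //; exact: measurable_L1_fun.
  apply: filterS3 ff (umulE (uind R A) F) (toL1E (Lfun_Sub _ fL)) => t ft -> -> _.
  rewrite uindE// patchE indicE /=; case: (t \in A); rewrite ?mul0r ?normr0// mul1r.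
  by rewrite ger0_norm ?fineK// fine_ge0.
(* On the set where [F > 1], the integral of [F - 1] is [phi] of the indicator minus its norm, hence
   at most 0; being nonnegative there, [F - 1] vanishes there. *)
have F1 : {ae mu, forall t, L1_fun F t <= 1}.
  pose A := [set t | 1 < L1_fun F t].
  have mA : measurable A.
    apply: measurable_lt_set; first exact: measurable_cst.
    exact: measurable_L1_fun.
  have : vle 0 (umul (uind R A) F - L1_indic A).
    apply/L1_ge0P; near=> t; rewrite (near (L1_funB _ _) t)//.
    rewrite (near (umulE _ _) t)// (near (L1_indicE mA) t)// uindE// indicE.
    case: (boolP (t \in A)) => [|tA]; last by rewrite mul0r subrr.
    by rewrite inE /A/= mul1r subr_ge0 => /ltW.
  move=> d0; have := aint_ge0E d0; rewrite aintB; last exact: L1_AL.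
  rewrite -phiF// (aint_ge0E (L1_indic_ge0 A)) => nd.
  have dA : umul (uind R A) F - L1_indic A = 0.
    apply/eqP; rewrite -normr_le0 -nd subr_le0.
    by apply: le_trans (ler_norm _) _; exact: phi_bd.
  near=> t; rewrite leNgt; apply/negP => tA.
  have : L1_fun (umul (uind R A) F) t = L1_fun (L1_indic A) t by rewrite (subr0_eq dA).
  rewrite (near (umulE _ _) t)// (near (L1_indicE mA) t)//.
  by rewrite uindE// indicE mem_set// mul1r => e; rewrite e ltxx in tA.
(* The truncation agrees with [F] almost everywhere and makes the bounds hold at every point. *)
pose k0 t := Num.min (fine (f t)) 1.
have k0P : measurable_fun setT k0 /\ forall t, 0 <= k0 t <= 1.
  split; last by move=> t; rewrite /k0 ge_min lexx orbT le_min ler01 fine_ge0.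
  by apply: measurable_minr => //; exact: measurableT_comp.
exists (exist _ k0 k0P) => x.
apply/eqP; rewrite -subr_eq0; apply/eqP.
have [C [_ mC HC]] := L1_simple_dense x.
apply: (HC (fun y => phi y - aint (umul (exist _ k0 k0P) y)) 2).
- move=> a y z; rewrite phi_lin umul_lin (aintD (@L1_AL _ _ _ _)) aintZ.
  by ring.
- move=> y; apply: le_trans (ler_normB _ _) _.
  have := le_trans (norm_aint _) (norm_umul (exist _ k0 k0P) y).
  by have := phi_bd y; lra.
- move=> A /mC mA; rewrite phiF// /L1_indic umulC.
  set E := umul (exist _ k0 k0P) _; suff -> : E = F by rewrite subrr.
  apply: L1_ext; near=> t; rewrite (near (umulE _ _) t)// (near L1_oneE t)//.
  have FE : L1_fun F t = fine (f t) by near: t; exact: toL1E.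
  have : L1_fun F t <= 1 by near: t.
  by rewrite mulr1 FE => f1; exact/min_idPl.
Unshelve. all: by end_near. Qed.

End L1_finite_measure.

(** * Closed sublattices of L_1 stable under multiplication by indicators *)

Section L1_closed_ideal.
Context d (T : measurableType d) (R : realType).
Variable mu : {measure set T -> \bar R}.

Lemma L1_fun_vabs (x : L1 mu) :
  {ae mu, forall t, L1_fun (vabs x) t = `|L1_fun x t|}.
Proof.
by apply: filterS2 (L1_fun_join x (- x)) (L1_funN x) => t -> ->; rewrite maxrN.
Qed.

Lemma L1_fun_sum_vabs (x : nat -> L1 mu) n : {ae mu, forall t,
  L1_fun (\sum_(0 <= i < n) vabs (x i)) t = \sum_(0 <= i < n) `|L1_fun (x i) t|}.
Proof.
elim: n => [|n ih].
  by rewrite big_geq//; apply: filterS (L1_fun0 mu) => t ->; rewrite big_geq.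
rewrite big_nat_recr//; near=> t; rewrite (near (L1_funD _ _) t)// big_nat_recr//.
by rewrite (near ih t)// (near (L1_fun_vabs _) t).
Unshelve. all: by end_near. Qed.

Variable D : set (L1 mu).
Hypothesis D_lin : forall (a : R) x y, D x -> D y -> D (a *: x + y).
Hypothesis D_vabs : forall x, D x -> D (vabs x).
Hypothesis D_closed :
  forall x, (forall e : R, 0 < e -> exists2 y, D y & `|x - y| <= e) -> D x.
Hypothesis D_uind : forall A x, D x -> D (umul (uind R A) x).

Let D0 x : D x -> D 0.
Proof. by move=> Dx; have := D_lin (-1) Dx Dx; rewrite scaleN1r addNr. Qed.

(* Halve the error by adding half of e where the error is at least that large. *)
Lemma L1_solid x e : D e -> vle 0 x -> vle x e -> D x.
Proof.
have arith (a b c : R) : a <= c * b -> a - 2^-1 * c * b <= 2^-1 * c * b by lra.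
move=> De x0 xe; have e0 := vle_trans x0 xe.
have De2 n : D (2^-1 ^+ n *: e).
  by have := D_lin (2^-1 ^+ n) De (D0 De); rewrite addr0.
have step n : exists y, [/\ D y, vle 0 (x - y) & vle (x - y) (2^-1 ^+ n *: e)].
  elim: n => [|n [y [Dy y0 ye]]].
    by exists 0; rewrite subr0 expr0 scale1r; split=> //; exact: D0 De.
  pose A := [set t | L1_fun (2^-1 ^+ n.+1 *: e) t <= L1_fun (x - y) t].
  have mA : measurable A.
    rewrite (_ : A = ~` [set t | L1_fun (x - y) t < L1_fun (2^-1 ^+ n.+1 *: e) t]).
      apply: measurableC; apply: measurable_lt_set; exact: measurable_L1_fun.
    by apply/seteqP; split=> t; rewrite /A /mkset leNgt => /negP.
  exists (y + umul (uind R A) (2^-1 ^+ n.+1 *: e)); split.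
  - rewrite addrC -[umul _ _]scale1r; apply: D_lin => //.
    by apply: D_uind; exact: De2.
  - have y0' := (L1_ge0P _).1 y0.
    rewrite opprD addrA; apply/L1_ge0P; near=> t.
    rewrite (near (L1_funB (x - y) _) t)// (near (umulE _ _) t)// uindE// indicE.
    case: (boolP (t \in A)) => [tA|_]; last first.
      by rewrite mul0r subr0 (near y0' t).
    by rewrite mul1r subr_ge0; move: tA; rewrite inE.
  - have ye' := (L1_vleP _ _).1 ye.
    rewrite opprD addrA; apply/L1_vleP; near=> t.
    rewrite (near (L1_funB (x - y) _) t)// (near (umulE _ _) t)// uindE// indicE.
    have h : L1_fun (x - y) t <= 2^-1 ^+ n * L1_fun e t.
      by rewrite -(near (L1_funZ _ _) t)// (near ye' t).
    have tA : (t \in A) = (2^-1 ^+ n.+1 * L1_fun e t <= L1_fun (x - y) t).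
      by rewrite -(near (L1_funZ _ _) t)//; apply/idP/idP; rewrite inE.
    rewrite tA (near (L1_funZ (2^-1 ^+ n.+1) e) t)//.
    have [_|/ltW] := leP (2^-1 ^+ n.+1 * L1_fun e t) (L1_fun (x - y) t).
      by rewrite mul1r exprS; exact: arith.
    by rewrite mul0r subr0.
apply: D_closed => eps eps0.
have c0 : (fun n => 2^-1 ^+ n * `|e| : R) @ \oo --> 0.
  rewrite -[X in _ --> X](mul0r `|e|); apply: cvgMl; apply: cvg_expr.
  by rewrite ger0_norm// invf_lt1// ltr1n.
move/cvgrPdist_le/(_ _ eps0) : c0 => [n _ /(_ n (leqnn n)) /= ne].
have [y [Dy y0 ye]] := step n; exists y => //.
apply: le_trans (norm_le_ge0 y0 ye) _; rewrite normrZ ger0_norm ?exprn_ge0//.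
by apply: le_trans ne; rewrite sub0r normrN ler_norm.
Unshelve. all: by end_near. Qed.

(** The truncations of [x] by [s n] lie in [D] by solidity. Where some [u m] is nonzero, [s n] is at
    least [n] times its absolute value once [n > m], so the truncation eventually equals [x];
    elsewhere [x] is 0. Dominated convergence then gives norm convergence. *)
Lemma L1_support (x : L1 mu) (u : nat -> L1 mu) : (forall n, D (u n)) ->
  vle 0 x ->
  {ae mu, forall t, (forall n, L1_fun (u n) t = 0) -> L1_fun x t = 0} -> D x.
Proof.
move=> Du x0 xu; pose s n := n%:R *: \sum_(0 <= i < n) vabs (u i).
have s0 n : vle 0 (s n).
  apply: vscale_ge0 => //; elim/big_ind: _ => [|y z y0 z0|i _].
  - exact: vle_refl.
  - by rewrite -[X in vle X _](addr0 0); exact: vleD.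
  - exact: vabs_ge0.
have Ds n : D (s n).
  have D00 := D0 (Du 0%N).
  rewrite -[s n]addr0; apply: D_lin => //; elim/big_ind: _ => // [y z Dy Dz|i _].
    by rewrite -[y]scale1r; exact: D_lin.
  exact: D_vabs.
have Dm n : D (vmeet x (s n)).
  by apply: (L1_solid (Ds n)); [apply/vmeetP|exact: vle_meetr].
have mE : {ae mu, forall t n, L1_fun (vmeet x (s n)) t =
    Num.min (L1_fun x t) (n%:R * \sum_(0 <= i < n) `|L1_fun (u i) t|)}.
  apply/ae_foralln => n.
  apply: filterS3 (L1_fun_meet x (s n)) (L1_funZ n%:R (\sum_(0 <= i < n) vabs (u i)))
    (L1_fun_sum_vabs u n) => t -> -> -> //.
have x0' := (L1_ge0P x).1 x0.
have mx (z : L1 mu) := measurable_L1_fun z.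
have [] := @dominated_convergence _ T R mu setT measurableT
  (fun n t => (L1_fun (vmeet x (s n)) t)%:E) (fun t => (L1_fun x t)%:E)
  (fun t => (L1_fun x t)%:E).
- by move=> n; exact/measurable_EFinP.
- exact/measurable_EFinP.
- apply: filterS3 mE x0' xu => t mE x0t xut _.
  apply: cvg_EFin; first exact: nearW.
  apply: cvg_near_cst.
  have [nz|/existsNP[m /eqP um]] := pselect (forall n, L1_fun (u n) t = 0).
    apply: nearW => n; rewrite -[LHS]/(L1_fun (vmeet x (s n)) t) mE (xut nz).
      apply/min_idPl; apply: mulr_ge0 => //.
    by apply: sumr_ge0.
  near=> n; rewrite -[LHS]/(L1_fun (vmeet x (s n)) t) mE; apply/min_idPl.
  have um0 : 0 < `|L1_fun (u m) t| by rewrite normr_gt0.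
  apply: (@le_trans _ _ (n%:R * `|L1_fun (u m) t|)).
    rewrite -ler_pdivrMr//.
    by near: n; exact: nbhs_infty_ger.
  rewrite ler_wpM2l//.
  have mn : (m < n)%N by near: n; exact: nbhs_infty_gt.
  by rewrite big_mkord (bigD1 (Ordinal mn))// lerDl sumr_ge0.
- by have /Lfun1_integrable := LfunP (L1_fun x).
- apply: filterS2 mE x0' => t mE x0t n _; rewrite mE lee_fin ger0_norm.
    by rewrite ge_min lexx.
  by rewrite le_min x0t mulr_ge0// sumr_ge0.
move=> _ + _ => /fine_cvgP[_ /cvgrPdist_le xs].
apply: D_closed => e e0; have [n _ /(_ n (leqnn n)) ne] := xs _ e0.
exists (vmeet x (s n)) => //.
have nE : (`|vmeet x (s n) - x|%:E =
    \int[mu]_t `|(L1_fun (vmeet x (s n)) t)%:E - (L1_fun x t)%:E|)%E.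
  rewrite L1_norm_int; apply: ae_eq_integral => //.
  - by apply/measurable_EFinP/measurableT_comp.
  - by apply/measurableT_comp => //; apply: emeasurable_funB; exact/measurable_EFinP.
  - by apply: filterS (L1_funB (vmeet x (s n)) x) => t ->.
rewrite distrC -[leLHS]/(fine (`|vmeet x (s n) - x|%:E)) nE.
by apply: le_trans ne; rewrite sub0r normrN; exact: ler_norm.
Unshelve. all: by end_near. Qed.

End L1_closed_ideal.

(** * The product measure on the cube *)

Section cube_measure_theory.
Context (R : realType) (J : choiceType).
Implicit Types (b : box_data R J) (j : J) (C : set R).

Local Notation Omega := (caratheodory_type (cube_outer_measure R J)).
Local Notation mu := (cube_measure R J).

Definition leb C : R := fine (lebesgue_measure (C `&` `[0, 1])).

Definition box_side b j : set R := if j \in b.1 then b.2 j else setT.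

(** For [j] outside [b.1] the value [b.2 j] is meaningless, so the new side is cut from [box_side],
    which is then the whole line. *)
Definition box_cut j C b : box_data R J :=
  ((j |` b.1)%fset, fun i => if i == j then box_side b j `&` C else b.2 i).

Lemma box_cutE j C b : box (box_cut j C b) = box b `&` [set x | C (val (x j))].
Proof.
rewrite /box /box_cut /box_side; apply/seteqP; split=> x /=.
  move=> h; split=> [i ib|]; last first.
    by have := h j; rewrite in_fset1U !eqxx /= => /(_ isT)[].
  have := h i; rewrite in_fset1U ib orbT => /(_ isT); case: eqP => // ij.
  by rewrite -ij ib => -[].
move=> [xb xC] i; rewrite in_fset1U; case: eqP => [-> _|_ /=]; last exact: xb.
by split=> //; case: ifP => // jb; exact: xb.
Qed.

Definition measurable_box b := forall i, measurable (b.2 i).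

Lemma measurable_box_side b j : measurable_box b -> measurable (box_side b j).
Proof. by move=> mb; rewrite /box_side; case: ifP. Qed.

Lemma measurable_box_cut j C b : measurable C -> measurable_box b ->
  measurable_box (box_cut j C b).
Proof.
move=> mC mb i; rewrite /box_cut /=; case: eqP => // _.
by apply: measurableI => //; exact: measurable_box_side.
Qed.

Lemma leb_setT : leb setT = 1.
Proof. by rewrite /leb setTI lebesgue_measure_itv /= lte_fin ltr01 oppr0 adde0. Qed.

Lemma leb_fin C : measurable C ->
  lebesgue_measure (C `&` `[0, 1]) \is a fin_num.
Proof.
move=> mC; rewrite ge0_fin_numE//.
apply: (@le_lt_trans _ _ (lebesgue_measure `[0 : R, 1]%classic)).
  by apply: le_measure; rewrite ?inE//; exact: measurableI.
by rewrite lebesgue_measure_itv /= lte_fin ltr01 oppr0 adde0 ltry.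
Qed.

Lemma leb_ge0 C : 0 <= leb C. Proof. exact: fine_ge0. Qed.

Lemma leb_split C C' : measurable C -> measurable C' ->
  leb C = leb (C `&` C') + leb (C `&` ~` C').
Proof.
move=> mC mC'; have mI := measurableI _ _ mC mC'.
have mD := measurableI _ _ mC (measurableC mC').
rewrite /leb -fineD ?leb_fin//.
rewrite -measureU; last 3 first.
- exact: measurableI.
- exact: measurableI.
- by apply/seteqP; split=> // t [[[_ ?] _] [[_ ?] _]].
congr (fine (lebesgue_measure _)).
apply/seteqP; split=> t /=; last by move=> [[[]]|[[]]].
move=> [Ct t01]; have [C't|nC't] := pselect (C' t); first by left.
by right.
Qed.

Definition box_rest j b : R := \prod_(i <- (b.1 `\ j)%fset) leb (b.2 i).

Lemma box_volumeE j b : box_volume b = (leb (box_side b j) * box_rest j b)%:E.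
Proof.
rewrite /box_volume /box_side /box_rest; congr EFin; case: ifPn => jb.
  by rewrite (big_fsetD1 j).
by rewrite leb_setT mul1r mem_fsetD1.
Qed.

Lemma box_volume_cut j C b :
  box_volume (box_cut j C b) = (leb (box_side b j `&` C) * box_rest j b)%:E.
Proof.
rewrite (box_volumeE j) /box_side /= fset1U1 eqxx; congr (_ * _)%:E.
rewrite /box_rest /=.
have -> : ((j |` b.1) `\ j = b.1 `\ j)%fset.
  by apply/fsetP => i; rewrite !inE; case: eqP.
rewrite !big_seq; apply: eq_bigr => i.
by rewrite in_fsetD1 => /andP[/negbTE -> _].
Qed.

Definition box_coords (c : option (box_data R J)) : {fset J} :=
  if c is Some b then b.1 else fset0.

Definition vol (c : option (box_data R J)) : \bar R := oapp (@box_volume R J) 0%E c.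

Lemma vol_ge0 c : (0 <= vol c)%E.
Proof.
case: c => [c|//]; rewrite lee_fin.
by apply: prodr_ge0 => i _; exact: leb_ge0.
Qed.

Lemma cube_outer_cover A c : box_cover A c ->
  (cube_outer A <= \sum_(k <oo) vol (c k))%E.
Proof. by move=> Ac; apply: ereal_inf_lbound; exists c. Qed.

Lemma box_cover_cut j C A c : measurable C -> box_cover A c ->
  box_cover (A `&` [set x | C (val (x j))]) (fun k => omap (box_cut j C) (c k)).
Proof.
move=> mC [mc Ac]; split=> [k b|x [/Ac [k _ xc] xC]].
  case E: (c k) => [b'|//] [<-]; apply: measurable_box_cut => //; exact: mc E.
exists k => //; move: xc; case: (c k) => //= b xb; rewrite box_cutE; split=> //.
Qed.

Lemma cube_outer_le1 (A : set (cube R J)) : (cube_outer A <= 1)%E.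
Proof.
(* The box without constraints is the whole cube, and its volume is an empty product. *)
pose b0 : box_data R J := (fset0, fun=> setT).
pose c k : option (box_data R J) := if k == 0%N then Some b0 else None.
apply: (le_trans (@cube_outer_cover A c _)).
  split=> [k b|x _]; first by rewrite /c; case: eqP => // _ [<-] i; exact: measurableT.
  by exists 0%N.
rewrite nneseries_recl//; last by move=> k _; exact: vol_ge0.
rewrite eseries0 ?adde0; last by move=> [|k].
by rewrite /c /vol /= /box_volume big_nil.
Qed.

Lemma cube_outer_fin (A : set (cube R J)) : (cube_outer A \is a fin_num)%E.
Proof.
rewrite ge0_fin_numE; first exact: le_lt_trans (cube_outer_le1 A) (ltry _).
exact: (outer_measure_ge0 (cube_outer_measure R J)).
Qed.

Lemma cube_outer_approx A (e : R) : 0 < e -> exists2 c, box_cover A c &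
  (\sum_(k <oo) vol (c k) <= cube_outer A + e%:E)%E.
Proof.
move=> e0; have [x [c Ac <-] cA] := lb_ereal_inf_adherent e0 (cube_outer_fin A).
by exists c => //; exact: ltW.
Qed.

(** Cutting the boxes of a nearly optimal cover of [A] by [C] and by its complement covers both
    parts of [A], and the volumes add up box by box: this is Caratheodory's criterion. *)
Lemma measurable_cylinder j C : measurable C ->
  measurable ([set x | C (val (x j))] : set Omega).
Proof.
move=> mC; apply: le_caratheodory_measurable => A.
apply/lee_addgt0Pr => e e0; have [c Ac cA] := cube_outer_approx A e0.
apply: le_trans cA; have mC' := measurableC mC.
have h1 := cube_outer_cover (box_cover_cut j mC Ac).
have h2 := cube_outer_cover (box_cover_cut j mC' Ac).
apply: (le_trans (leeD h1 h2)); rewrite -nneseriesD//; last 2 first.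
- by move=> k _ _; exact: vol_ge0.
- by move=> k _ _; exact: vol_ge0.
apply: lee_nneseries => [k _ _|k _]; first by rewrite adde_ge0 ?vol_ge0.
case E : (c k) => [b|] /=; last by rewrite adde0.
have mb : measurable_box b by exact: Ac.1 E.
rewrite /vol /= !box_volume_cut (box_volumeE j) -EFinD -mulrDl.
by rewrite -leb_split//; exact: measurable_box_side.
Qed.

Lemma measurable_coord j : measurable_fun setT (fun x : Omega => val (x j) : R).
Proof. by move=> _ C mC; rewrite setTI; exact: measurable_cylinder. Qed.

Lemma leb_lt (c : R) : 0 <= c <= 1 -> leb [set t | t < c] = c.
Proof.
move=> /andP[c0 c1]; rewrite /leb; have -> : [set t | t < c] `&` `[0, 1] = `[0, c[%classic.
  apply/seteqP; split=> t /=; rewrite !in_itv /=; first by move=> [-> /andP[->]].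
  by move=> /andP[-> tc]; split=> //; rewrite ltW// (lt_le_trans tc).
rewrite lebesgue_measure_itv /= lte_fin.
by move: c0; rewrite le_eqVlt => /predU1P[<-|->]; rewrite ?ltxx//= oppr0 addr0.
Qed.

(* The coordinates involved in the covers of a set realizing its measure are
   countably many, and the other coordinates are independent of the set. *)
Lemma cube_measure_fresh (A : set Omega) : measurable A ->
  exists2 K : set J, countable K & forall j, ~ K j -> forall c : R, 0 <= c <= 1 ->
    (mu (A `&` [set x | (val (x j) < c)%R]) = c%:E * mu A)%E.
Proof.
move=> mA; have /choice[c Ac] : forall n, exists c, box_cover A c /\
    (\sum_(k <oo) vol (c k) <= cube_outer A + n.+1%:R^-1%:E)%E.
  by move=> n; have [|c ? ?] := @cube_outer_approx A n.+1%:R^-1; [|exists c].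
exists (\bigcup_n \bigcup_k [set` box_coords (c n k)]).
  by apply: bigcup_countable => // n _; apply: bigcup_countable => // k _.
move=> j nKj t t01.
(* Covers give upper bounds only. Applied to the set below [t] and to its complement, of lengths [t]
   and [1 - t], these bounds add up to [mu A], so both are equalities. *)
have bound (C : set R) : measurable C ->
    (mu (A `&` [set x | C (val (x j))]) <= (leb C)%:E * mu A)%E.
  move=> mC; apply/lee_addgt0Pr => e e0.
  have [n _ /(_ n (leqnn n)) /= ne] := near_infty_natSinv_lt (PosNum e0).
  have [Acn cn] := Ac n.
  apply: (le_trans (cube_outer_cover (box_cover_cut j mC Acn))).
  apply: (@le_trans _ _ ((leb C)%:E * \sum_(k <oo) vol (c n k))%E).
    rewrite -nneseriesZl; last by move=> k _; exact: vol_ge0.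
    apply: lee_nneseries => [k _ _|k _]; first exact: vol_ge0.
    have njc : j \notin box_coords (c n k).
      by apply/negP => jc; apply: nKj; exists n => //; exists k.
    case: (c n k) njc => [b|] /= njb; last by rewrite mule0.
    rewrite /vol /= box_volume_cut (box_volumeE j) -EFinM lee_fin.
    by rewrite /box_side (negbTE njb) setTI leb_setT mul1r.
  apply: (@le_trans _ _ ((leb C)%:E * (mu A + n.+1%:R^-1%:E))%E).
    by rewrite lee_wpmul2l// lee_fin leb_ge0.
  rewrite muleDr ?fin_num_adde_defl// leeD2l// -EFinM lee_fin.
  have C1 : leb C <= 1.
    by rewrite -leb_setT (leb_split measurableT mC) !setTI lerDl leb_ge0.
  apply: le_trans (ltW ne); rewrite ler_piMl// invr_ge0//.
pose H : set Omega := [set x | val (x j) < t].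
have mlt : measurable [set s : R | s < t].
  by rewrite (_ : [set s | _] = `]-oo, t[%classic)//; exact: measurable_itv.
have mH : measurable H by exact: (measurable_cylinder j mlt).
have b1 := bound _ mlt; have b2 := bound _ (measurableC mlt).
have l2 : leb (~` [set s : R | s < t]) = 1 - t.
  have := leb_split measurableT mlt; rewrite leb_setT !setTI leb_lt//; lra.
rewrite leb_lt// in b1; rewrite l2 in b2.
have muE : mu A = (mu (A `&` H) + mu (A `&` ~` H))%E.
  rewrite -measureU//; last 3 first.
  - exact: measurableI.
  - by apply: measurableI => //; exact: measurableC.
  - by rewrite setIACA setICr setI0.
  by rewrite -setIUr setUCr setIT.
have val (B : set Omega) : exists r, mu B = r%:E.
  by exists (fine (mu B)); rewrite fineK//; exact: cube_outer_fin.
have {}b1 : (mu (A `&` H) <= t%:E * mu A)%E := b1.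
have {}b2 : (mu (A `&` ~` H) <= (1 - t)%:E * mu A)%E := b2.
suff : (mu (A `&` H) = t%:E * mu A)%E by [].
have [[m mE] [a aE] [b bE]] := And3 (val A) (val (A `&` H)) (val (A `&` ~` H)).
move: b1 b2 muE; rewrite mE aE bE -EFinD -!EFinM !lee_fin => b1 b2 [muE].
by congr EFin; apply/eqP; rewrite eq_le; lra.
Qed.

(* The measure of the slice of a box where the coordinates in F are those of x. *)
Definition box_slice (F : {fset J}) (x : J -> R) b : R :=
  \prod_(i <- b.1) (if i \in F then \1_(b.2 i) (x i) else leb (b.2 i)).

Definition cover_slice F x (c : option (box_data R J)) : \bar R :=
  oapp (fun b => (box_slice F x b)%:E) 0%E c.

Lemma cover_slice_ge0 F x c : (0 <= cover_slice F x c)%E.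
Proof.
case: c => [b|//]; rewrite lee_fin; apply: prodr_ge0 => i _.
by case: ifP => // _; exact: leb_ge0.
Qed.

(** The factor [r] comes from the coordinates other than [j]. Integrating over [t] in [0, 1] turns
    the indicator into [leb] of the side: this is Fubini in one variable. *)
Lemma box_slice_add F x j b : j \notin F -> exists2 r : R, 0 <= r &
  box_slice F x b = leb (box_side b j) * r /\
  forall t : R, box_slice (j |` F)%fset (fun i => if i == j then t else x i) b =
    \1_(box_side b j) t * r.
Proof.
move=> jF; exists (\prod_(i <- (b.1 `\ j)%fset)
    (if i \in F then \1_(b.2 i) (x i) else leb (b.2 i))).
  by apply: prodr_ge0 => i _; case: ifP => // _; exact: leb_ge0.
rewrite /box_slice /box_side; case: ifPn => jb; last first.
  rewrite leb_setT mul1r mem_fsetD1//; split=> // t.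
  rewrite indicT mul1r !big_seq; apply: eq_bigr => i ib.
  by rewrite in_fset1U; case: eqP => // ij; rewrite -ij ib in jb.
rewrite (big_fsetD1 j)//= (negbTE jF); split=> // t.
rewrite (big_fsetD1 j)//= fset1U1 eqxx !big_seq; congr (_ * _).
by apply: eq_bigr => i; rewrite in_fsetD1 in_fset1U => /andP[/negbTE->].
Qed.

(** By [box_slice_add], the sum for [x] is the integral over [0, 1] of the sums obtained by fixing
    coordinate [j] at [t]. If all of these were at least 1, so would be the integral. *)
Lemma slice_choice F x j (c : nat -> option (box_data R J)) :
  (forall k b, c k = Some b -> measurable_box b) -> j \notin F ->
  (\sum_(k <oo) cover_slice F x (c k) < 1)%E ->
  exists2 t : R, 0 <= t <= 1 & (\sum_(k <oo) cover_slice (j |` F)%fset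
    (fun i => if i == j then t else x i) (c k) < 1)%E.
Proof.
move=> mc jF; apply: contraPP => /forall2NP no; apply/negP; rewrite -leNgt.
have m01 : measurable (`[0, 1]%classic : set R) by [].
have sliceE k : exists C (r : R), [/\ measurable C, 0 <= r,
    cover_slice F x (c k) = (leb C * r)%:E &
    forall t, cover_slice (j |` F)%fset (fun i => if i == j then t else x i) (c k) =
      (\1_C t * r)%:E].
  case E : (c k) => [b|]; last first.
    by exists set0, 0; split=> // [|t]; rewrite ?mulr0.
  have [r r0 [e1 e2]] := box_slice_add x b jF.
  exists (box_side b j), r; split=> // [||t]; last by rewrite /cover_slice /= e2.
    by apply: measurable_box_side; exact: mc E.
  by rewrite /cover_slice /= e1.
have -> : (\sum_(k <oo) cover_slice F x (c k) =
    \int[lebesgue_measure]_(t in `[0%R, 1%R]) \sum_(k <oo)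
      cover_slice (j |` F)%fset (fun i => if i == j then t else x i) (c k))%E.
  rewrite integral_nneseries//; last 2 first.
  - move=> k; have [C [r [mC r0 _ e2]]] := sliceE k.
    apply: (eq_measurable_fun (fun t => (\1_C t * r)%:E)) => [t _|].
      exact: esym (e2 t).
    by apply/measurable_EFinP; apply: measurable_funM => //; exact: measurable_indic.
  - by move=> k t _; exact: cover_slice_ge0.
  apply: eq_eseriesr => k _; have [C [r [mC r0 -> e2]]] := sliceE k.
  transitivity (\int[lebesgue_measure]_(t in `[0%R, 1%R]) ((\1_C t)%:E * r%:E))%E; last first.
    by apply: eq_integral => t _; exact: esym (e2 t).
  rewrite ge0_integralZr//; last first.
    by apply/measurable_EFinP; exact: measurable_indic.
  by rewrite integral_indic// EFinM fineK// leb_fin.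
have <- : (\int[lebesgue_measure]_(t in `[0%R, 1%R]) (cst 1 t) = 1 :> \bar R)%E.
  rewrite integral_cst// mul1e.
  have : lebesgue_measure (`[0%R, 1%R]%classic : set R) = 1%E.
    by rewrite lebesgue_measure_itv /= lte_fin ltr01 oppr0 adde0.
  exact.
apply: ge0_le_integral => //.
- apply: ge0_emeasurable_sum => [k t _ _|k _]; first exact: cover_slice_ge0.
  have [C [r [mC r0 _ e2]]] := sliceE k.
  apply: (eq_measurable_fun (fun t => (\1_C t * r)%:E)) => [t _|].
    exact: esym (e2 t).
  by apply/measurable_EFinP; apply: measurable_funM => //; exact: measurable_indic.
- move=> t; rewrite /= in_itv /= => t01; rewrite leNgt; apply/negP => lt1.
  by have [] := no t.
Qed.

Lemma slice_choices F x (G : seq J) (c : nat -> option (box_data R J)) :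
  (forall k b, c k = Some b -> measurable_box b) -> (forall i, 0 <= x i <= 1) ->
  (\sum_(k <oo) cover_slice F x (c k) < 1)%E ->
  exists y : J -> R, [/\ forall i, 0 <= y i <= 1, forall i, i \in F -> y i = x i &
    (\sum_(k <oo) cover_slice (F `|` [fset i in G])%fset y (c k) < 1)%E].
Proof.
move=> mc x01 Fx; elim: G => [|j G [y [y01 yx yc]]].
  exists x; split=> //; suff -> : (F `|` [fset i in [::]] = F)%fset by [].
  by apply/fsetP => i; rewrite !inE orbF.
set H := (F `|` [fset i in G])%fset in yc.
have HE : (F `|` [fset i in j :: G] = j |` H)%fset.
  by apply/fsetP => i; rewrite !inE orbCA.
rewrite HE; have [jH|jH] := boolP (j \in H).
  by exists y; split=> //; rewrite (fsetUidPr _ _ _) ?fsub1set.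
have [t t01 tc] := slice_choice mc jH yc.
exists (fun i => if i == j then t else y i); split=> // [i|i iF].
  by case: ifP.
case: eqP => [ij|_]; last exact: yx.
by move: jH; rewrite -ij in_fsetU iF.
Qed.

(* Choosing the coordinates of a point one after the other so that the total
   measure of the slices stays below 1 yields a point outside all the boxes. *)
Lemma cube_outer_setT : cube_outer (setT : set (cube R J)) = 1%E.
Proof.
apply/eqP; rewrite eq_le cube_outer_le1 /=.
apply: le_ereal_inf_tmp => _ [c [mc cT] <-]; rewrite leNgt; apply/negP => c1.
pose F n := \big[fsetU/fset0]_(k < n) box_coords (c k).
have FS n : F n.+1 = (F n `|` [fset i in (box_coords (c n) : seq J)])%fset.
  rewrite /F big_ord_recr /=; congr (_ `|` _)%fset.
  by apply/fsetP => i; rewrite !inE.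
(* The conditions stand under the existential so that choice yields a successor function on all
   pairs; where they fail, [s.2] is a default. *)
have step (s : nat * (J -> R)) : exists y : J -> R,
    (forall i, 0 <= s.2 i <= 1) ->
    (\sum_(k <oo) cover_slice (F s.1) s.2 (c k) < 1)%E ->
    [/\ forall i, 0 <= y i <= 1, forall i, i \in F s.1 -> y i = s.2 i &
      (\sum_(k <oo) cover_slice (F s.1.+1) y (c k) < 1)%E].
  have [[s01 sc]|h] := pselect ((forall i, 0 <= s.2 i <= 1) /\
    (\sum_(k <oo) cover_slice (F s.1) s.2 (c k) < 1)%E); last first.
    by exists s.2 => h1 h2; case: h.
  have [y [y01 yx yc]] := slice_choices (box_coords (c s.1)) mc s01 sc.
  exists y => _ _; split=> //; move: yc; set H := (_ `|` _)%fset.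
  by have -> : H = F s.1.+1 by apply/fsetP => i; rewrite FS !inE.
have /choice[nxt nxtP] := step.
pose x := fix x n := if n is m.+1 then nxt (m, x m) else (fun=> 0) : J -> R.
have xP n : (forall i, 0 <= x n i <= 1) /\
    (\sum_(k <oo) cover_slice (F n) (x n) (c k) < 1)%E.
  elim: n => [|n [x01 xc]]; last by have [] := nxtP (n, x n) x01 xc.
  split=> [i|]; first by rewrite /= lexx ler01.
  apply: le_lt_trans c1; apply: lee_nneseries => [k _ _|k _].
    exact: cover_slice_ge0.
  by rewrite /F big_ord0; case: (c k).
have xS n i : i \in F n -> x n.+1 i = x n i.
  by have [x01 xc] := xP n; have [_ + _] := nxtP (n, x n) x01 xc; apply.
have FM n m i : (n <= m)%N -> i \in F n -> i \in F m /\ x m i = x n i.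
  move=> /subnK <-; elim: (m - n)%N => [//|k ih] /ih [iF <-].
  by rewrite addSn; split; [rewrite FS in_fsetU iF|exact: xS].
have /choice[y yP] : forall i, exists r, 0 <= r <= 1 /\
    forall n, i \in F n -> x n i = r.
  move=> i; have [[n iF]|no] := pselect (exists n, i \in F n); last first.
    by exists 0; rewrite lexx ler01; split=> // n iF; case: no; exists n.
  exists (x n i); split=> [|m iF']; first by have [+ _] := xP n; apply.
  have [nm|/ltnW mn] := leqP n m; first by have [] := FM _ _ _ nm iF.
  by have [_ ->] := FM _ _ _ mn iF'.
pose p : cube R J := fun i => exist _ (y i) (yP i).1.
have [k _] := cT p I; case E : (c k) => [b|//] pb.
(* The cover puts [p] in box [k], whose coordinates are all fixed at stage [k.+1]. The slice of that
   box is therefore 1, against a total below 1. *)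
have [_] := xP k.+1; apply/negP; rewrite -leNgt.
apply: (@le_trans _ _ (cover_slice (F k.+1) (x k.+1) (c k))).
  rewrite E /cover_slice lee_fin /box_slice big_seq big1// => i ib.
  have iF : i \in F k.+1 by rewrite FS E !inE ib orbT.
  by rewrite iF ((yP i).2 _ iF) indicE mem_set//; exact: (pb i ib).
rewrite (@nneseriesD1 _ _ k xpredT)//; last by move=> n _; exact: cover_slice_ge0.
by rewrite leeDl// nneseries_ge0// => n _ _; exact: cover_slice_ge0.
Qed.

Lemma cube_measureT : mu setT = 1%E.
Proof. exact: cube_outer_setT. Qed.

Lemma cube_measure_fin_num : fin_num_fun mu.
Proof. by move=> A _; exact: cube_outer_fin. Qed.

End cube_measure_theory.

(** * Replacing a density by the indicator of a set cut out by a fresh coordinate *)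

Section L1_cube.
Context (R : realType) (J : choiceType).

Local Notation Omega := (caratheodory_type (cube_outer_measure R J)).
Local Notation mu := (cube_measure R J).
Local Notation X := (L1 mu).
Local Notation fin := (@cube_measure_fin_num R J).

Definition below j (c : R) : set Omega := [set t | val (t j) < c].

Lemma measurable_below j c : measurable (below j c).
Proof. exact: (measurable_lt_set (measurable_coord j) (measurable_cst c)). Qed.

(** Both sides are bounded linear functionals of [x], so it is enough to treat the countably many
    sets of [L1_simple_dense], each of which excludes countably many coordinates. *)
Lemma L1_fresh (x : X) : exists2 K : set J, countable K &
  forall j, ~ K j -> forall c : R, 0 <= c <= 1 ->
    aint (umul (uind R (below j c)) x) = c * aint x.
Proof.
have [C [cC mC HC]] := L1_simple_dense fin x.
have /choice[K KP] : forall A : set Omega, exists K : set J, measurable A ->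
    countable K /\ forall j, ~ K j -> forall c : R, 0 <= c <= 1 ->
      (mu (A `&` below j c) = c%:E * mu A)%E.
  move=> A; have [mA|nA] := pselect (measurable A); last by exists set0.
  by have [K cK HK] := cube_measure_fresh mA; exists K.
exists (\bigcup_(A in C) K A).
  by apply: bigcup_countable => // A /mC mA; exact: (KP _ mA).1.
move=> j nKj c c01; apply/eqP; rewrite -subr_eq0; apply/eqP.
apply: (HC (fun y => aint (umul (uind R (below j c)) y) - c * aint y) 2).
- move=> a y z; rewrite umul_lin !(aintD (@L1_AL _ _ _ _)) !aintZ; ring.
- move=> y; apply: le_trans (ler_normB _ _) _.
  have h1 := le_trans (norm_aint _) (norm_umul (uind R (below j c)) y).
  have h2 : `|c * aint y| <= `|y|.
    rewrite normrM; have /andP[c0 c1] := c01; rewrite (ger0_norm c0).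
    by rewrite (le_trans _ (norm_aint y))// ler_piMl.
  lra.
- move=> A CA; have mA := mC _ CA; have mB := measurable_below j c.
  have mAB := measurableI _ _ mA mB.
  have -> : umul (uind R (below j c)) (L1_indic fin A) = L1_indic fin (A `&` below j c).
    apply: L1_ext; near=> t; rewrite (near (umulE _ _) t)//.
    rewrite (near (L1_indicE fin mA) t)// (near (L1_indicE fin mAB) t)//.
    by rewrite uindE// !indicE in_setI -mulnb natrM mulrC.
  rewrite !aint_ge0E; [|exact: L1_indic_ge0..].
  apply/eqP; rewrite subr_eq0; apply/eqP; apply: EFin_inj.
  rewrite EFinM !norm_L1_indic//.
  by have [_] := KP _ mA; apply => // KAj; apply: nKj; exists A.
Unshelve. all: by end_near. Qed.

(** When [k] does not depend on coordinate [j], a uniform [t j] falls below [k] with conditional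
    probability [k]; the indicator of this set then integrates like [k] against functions
    independent of [t j]. *)
Definition below_mult j (k : umult Omega R) : set Omega :=
  [set t | val (t j) < sval k t].

Lemma measurable_below_mult j k : measurable (below_mult j k).
Proof.
apply: measurable_lt_set; [exact: measurable_coord|exact: measurable_umult].
Qed.

Lemma aint_uind_le (A B : set Omega) (z : X) : measurable A -> measurable B ->
  vle 0 z -> {ae mu, forall t, L1_fun z t = 0 \/ (A t -> B t)} ->
  aint (umul (uind R A) z) <= aint (umul (uind R B) z).
Proof.
move=> mA mB /L1_ge0P z0 zAB; apply: aint_mono; first exact: L1_AL.
apply/L1_vleP; near=> t; rewrite !(near (umulE _ _) t)// !uindE//.
have z0t : 0 <= L1_fun z t by near: t.
have [->|AB] : L1_fun z t = 0 \/ (A t -> B t) by near: t.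
  by rewrite !mulr0.
rewrite ler_wpM2r// !indicE ler_nat.
by case: (boolP (t \in A)) => //; rewrite inE => /AB Bt; rewrite mem_set.
Unshelve. all: by end_near. Qed.

(** On the support of [z] the set [below_mult j k] lies between [below j a] and [below j b], whose
    integrals are known by freshness. Both compared quantities thus lie between [a] and [b] times
    the integral of [z]. *)
Lemma L1_fresh_mult_level (k : umult Omega R) j (z : X) (a b : R) :
  0 <= a <= 1 -> 0 <= b <= 1 -> vle 0 z ->
  (forall c : R, 0 <= c <= 1 -> aint (umul (uind R (below j c)) z) = c * aint z) ->
  {ae mu, forall t, L1_fun z t = 0 \/ a < sval k t <= b} ->
  `|aint (umul (uind R (below_mult j k)) z) - aint (umul k z)| <= (b - a) * `|z|.
Proof.
move=> a01 b01 z0 fresh zk; have z0' := (L1_ge0P z).1 z0.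
have AL := @L1_AL _ _ _ mu.
have mk := measurable_below_mult j k.
have h1 : a * aint z <= aint (umul (uind R (below_mult j k)) z).
  rewrite -fresh//; apply: aint_uind_le => //; first exact: measurable_below.
  apply: filterS zk => t [->|/andP[ak _]]; [by left|right].
  by move=> ta; exact: lt_trans ta ak.
have h2 : aint (umul (uind R (below_mult j k)) z) <= b * aint z.
  rewrite -fresh//; apply: aint_uind_le => //; first exact: measurable_below.
  apply: filterS zk => t [->|/andP[_ kb]]; [by left|right].
  by move=> ta; exact: lt_le_trans ta kb.
have h3 : a * aint z <= aint (umul k z).
  rewrite -aintZ; apply: aint_mono => //; apply/L1_vleP.
  apply: filterS2 (filterI zk z0') (filterI (L1_funZ a z) (umulE k z)).
  move=> t [zkt z0t] [-> ->].
  by case: zkt => [->|/andP[/ltW ak _]]; [rewrite !mulr0|exact: ler_wpM2r].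
have h4 : aint (umul k z) <= b * aint z.
  rewrite -aintZ; apply: aint_mono => //; apply/L1_vleP.
  apply: filterS2 (filterI zk z0') (filterI (L1_funZ b z) (umulE k z)).
  move=> t [zkt z0t] [-> ->].
  by case: zkt => [->|/andP[_ kb]]; [rewrite !mulr0|exact: ler_wpM2r].
rewrite -(aint_ge0E z0) mulrBl ler_norml; apply/andP; split; lra.
Qed.

(* Cut x along the level sets of k: where m / N < k <= m.+1 / N, both sides lie
   between m / N and m.+1 / N times the integral of x. *)
Lemma L1_fresh_mult_ge0 (k : umult Omega R) (x : X) : vle 0 x ->
  exists2 K : set J, countable K & forall j, ~ K j ->
    aint (umul (uind R (below_mult j k)) x) = aint (umul k x).
Proof.
move=> x0; have x0' := (L1_ge0P x).1 x0.
(* [L N m] is the set where [k <= m / (N + 1)], so [y N 0] is the part of [x] over [k = 0] and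
   [y N N.+1] is all of [x]. *)
pose L N m : set Omega := ~` [set t | m%:R < N.+1%:R * sval k t].
have mL N m : measurable (L N m).
  apply: measurableC; apply: measurable_lt_set; first exact: measurable_cst.
  by apply: measurable_funM; [exact: measurable_cst|exact: measurable_umult].
have LE N m t : (t \in L N m) = (N.+1%:R * sval k t <= m%:R).
  by apply/idP/idP; rewrite inE /L /setC /mkset leNgt => /negP.
pose y N m := umul (uind R (L N m)) x.
pose z N m := y N m.+1 - y N m.
have zE N m : {ae mu, forall t, 0 <= L1_fun (z N m) t /\ (L1_fun (z N m) t = 0 \/
    m%:R / N.+1%:R < sval k t <= m.+1%:R / N.+1%:R)}.
  near=> t; rewrite (near (L1_funB _ _) t)// !(near (umulE _ _) t)//.
  rewrite !uindE// !indicE !LE.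
  have x0t : 0 <= L1_fun x t by near: t.
  rewrite ltr_pdivrMr// ler_pdivlMr// ![sval k t * _]mulrC.
  case: (leP _ m%:R) => [km|mk].
    have -> : N.+1%:R * sval k t <= m.+1%:R by rewrite (le_trans km)// ler_nat.
    by rewrite subrr; split=> //; left.
  rewrite mul0r subr0; case: (leP _ m.+1%:R) => km; last by rewrite mul0r; split=> //; left.
  by rewrite mul1r; split=> //; right.
have z0 N m : vle 0 (z N m).
  by apply/L1_ge0P; apply: filterS (zE N m) => t [].
(* Asking freshness of the pieces [z N m], rather than of [x] alone, makes [j] independent of the
   level sets of [k] as well. *)
have /choice[K KP] : forall Nm : nat * nat, exists K : set J, countable K /\
    forall j, ~ K j -> forall c : R, 0 <= c <= 1 ->
    aint (umul (uind R (below j c)) (z Nm.1 Nm.2)) = c * aint (z Nm.1 Nm.2).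
  by move=> Nm; have [K cK HK] := L1_fresh (z Nm.1 Nm.2); exists K.
exists (\bigcup_Nm K Nm).
  by apply: bigcup_countable => // Nm _; exact: (KP _).1.
move=> j nKj; pose D (u : X) := aint (umul (uind R (below_mult j k)) u) - aint (umul k u).
have AL := @L1_AL _ _ _ mu.
have DD (u v : X) : D (u + v) = D u + D v.
  by rewrite /D !umulD !aintD//; ring.
have Dz N m : (m < N.+1)%N -> `|D (z N m)| <= N.+1%:R^-1 * `|z N m|.
  move=> mN; have -> : N.+1%:R^-1 = m.+1%:R / N.+1%:R - m%:R / N.+1%:R :> R.
    by rewrite -mulrBl -natrB// subSnn mul1r.
  apply: L1_fresh_mult_level => //.
  - by rewrite divr_ge0//= ler_pdivrMr// mul1r ler_nat ltnW.
  - by rewrite divr_ge0//= ler_pdivrMr// mul1r ler_nat.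
  - by apply: (KP (N, m)).2 => Kj; apply: nKj; exists (N, m).
  - by apply: filterS (zE N m) => t [].
(* The part over [k = 0] belongs to none of the pieces [z N m]. Both operators kill it, since a
   coordinate is never negative. *)
have y0 N : D (y N 0%N) = 0.
  have e1 : umul (uind R (below_mult j k)) (y N 0%N) = 0.
    apply: L1_ext; near=> t; rewrite !(near (umulE _ _) t)// (near (L1_fun0 mu) t)//.
    rewrite !uindE//; last exact: measurable_below_mult.
    rewrite !indicE LE; case: (leP _ 0%:R) => [|_]; last by rewrite mul0r mulr0.
    rewrite pmulr_rle0// => k0; rewrite memNset ?mul0r//.
    move=> /lt_le_trans/(_ k0); apply/negP; rewrite -leNgt.
    by case/andP: (valP (t j)).
  have e2 : umul k (y N 0%N) = 0.
    apply: L1_ext; near=> t; rewrite !(near (umulE _ _) t)// (near (L1_fun0 mu) t)//.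
    rewrite uindE// indicE LE; case: (leP _ 0%:R) => [|_]; last by rewrite mul0r mulr0.
    rewrite pmulr_rle0// => k0.
    have -> : sval k t = 0 by apply/eqP; rewrite eq_le k0 umult_ge0.
    by rewrite mul0r.
  by rewrite /D e1 e2 subrr.
have yD N m : y N m.+1 = y N m + z N m by rewrite /z addrC subrK.
have y_ge0 N m : vle 0 (y N m) by exact: umul_ge0.
(* The pieces are positive, so their norms add up and the total error stays [1 / (N + 1)] times the
   norm of the sum, however many pieces there are. *)
have Dy N m : (m <= N.+1)%N -> `|D (y N m)| <= N.+1%:R^-1 * `|y N m|.
  elim: m => [|m ih] mN; first by rewrite y0 normr0 mulr_ge0// invr_ge0.
  rewrite yD DD AL// mulrDr; apply: le_trans (ler_normD _ _) _.
  by apply: lerD; [exact: ih (ltnW mN)|exact: Dz].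
have yx N : y N N.+1 = x.
  apply: L1_ext; near=> t; rewrite (near (umulE _ _) t)// uindE// indicE LE.
  by rewrite ler_piMr ?umult_le1// mul1r.
apply/eqP; rewrite -subr_eq0 -normr_le0; apply/ler_addgt0Pr => e e0; rewrite add0r.
have x1 : 0 < `|x| + 1 by rewrite ltr_wpDl.
have ex : 0 < e / (`|x| + 1) by rewrite divr_gt0.
have [N _ /(_ N (leqnn N)) /= Ne] := near_infty_natSinv_lt (PosNum ex).
have := Dy N N.+1 (leqnn _); rewrite yx => /le_trans; apply.
apply: (@le_trans _ _ (e / (`|x| + 1) * (`|x| + 1))).
  by apply: ler_pM => //; [exact: ltW|rewrite lerDl].
by rewrite divfK// gt_eqF.
Unshelve. all: by end_near. Qed.

Lemma L1_fresh_mult (k : umult Omega R) (x : X) :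
  exists2 K : set J, countable K & forall j, ~ K j ->
    aint (umul (uind R (below_mult j k)) x) = aint (umul k x).
Proof.
have [K1 c1 H1] := L1_fresh_mult_ge0 k (vpos_ge0 x).
have [K2 c2 H2] := L1_fresh_mult_ge0 k (vpos_ge0 (- x)).
exists (K1 `|` K2); first by rewrite -bigcup2E; apply: bigcup_countable => // -[|[|n]].
move=> j nK; rewrite -(vposB x) !umulB !(aintB (@L1_AL _ _ _ _)).
by rewrite H1 ?H2// => Kj; apply: nK; [right|left].
Qed.

End L1_cube.

(** * The l_1-sum *)

Section ell1_theory.
Context (R : realType) (I : choiceType) (X : banachLatticeType R).
Implicit Types x y : ell1 I X.

Lemma ell1_funD x y i : (x + y) i = x i + y i. Proof. by []. Qed.
Lemma ell1_funB x y i : (x - y) i = x i - y i. Proof. by []. Qed.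
Lemma ell1_funZ (a : R) x i : (a *: x) i = a *: x i. Proof. by []. Qed.
Lemma ell1_fun_join x y i : vjoin x y i = vjoin (x i) (y i). Proof. by []. Qed.
Lemma ell1_fun_vabs x i : vabs x i = vabs (x i). Proof. by []. Qed.

Lemma ell1_AL : AL_space X -> AL_space (ell1 I X).
Proof.
move=> AL x y x0 y0; apply: EFin_inj; rewrite EFinD !normell1E -esumD//.
by apply: eq_esum => i _; rewrite ell1_funD AL//; [exact: x0|exact: y0].
Qed.

Lemma ell1_at_fin i (z : X) :
  (\esum_(k in [set: I]) `|if k == i then z else 0|%:E < +oo)%E.
Proof.
have -> : (fun k => `|if k == i then z else 0|%:E) =
    (fun k => if k \in [set i] then `|z|%:E else 0%E).
  apply/funext => k; rewrite (_ : (k \in [set i]) = (k == i)); last first.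
    by apply/idP/eqP; rewrite inE.
  by case: ifP => //; rewrite normr0.
by rewrite -esum_mkcond esum_set1 ?ltry.
Qed.

Definition ell1_at i (z : X) : ell1 I X := Ell1 (ell1_at_fin i z).

Lemma ell1_atE i (z : X) k : ell1_at i z k = if k == i then z else 0.
Proof. by []. Qed.

Lemma norm_ell1_at i (z : X) : `|ell1_at i z| = `|z|.
Proof.
apply: EFin_inj; rewrite normell1E.
have -> : (fun k => `|ell1_at i z k|%:E) =
    (fun k => if k \in [set i] then `|z|%:E else 0%E).
  apply/funext => k; rewrite (_ : (k \in [set i]) = (k == i)); last first.
    by apply/idP/eqP; rewrite inE.
  by rewrite ell1_atE; case: ifP => //; rewrite normr0.
by rewrite -esum_mkcond esum_set1.
Qed.

Lemma ell1_at_lin i (a : R) (z z' : X) :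
  ell1_at i (a *: z + z') = a *: ell1_at i z + ell1_at i z'.
Proof.
apply: ell1P => k; rewrite ell1_funD ell1_funZ !ell1_atE.
by case: eqP => // _; rewrite scaler0 addr0.
Qed.

Lemma ell1_at_vpos i (z : X) : vpos (ell1_at i z) = ell1_at i (vpos z).
Proof.
apply: ell1P => k; rewrite ell1_fun_join !ell1_atE.
by case: eqP => // _; rewrite vjoinxx.
Qed.

Lemma aint_ell1_at i (z : X) : aint (ell1_at i z) = aint z.
Proof.
have atN : - ell1_at i z = ell1_at i (- z).
  apply: ell1P => k; rewrite -[LHS]/(- (ell1_at i z k)) !ell1_atE.
  by case: eqP => // _; rewrite oppr0.
by rewrite /aint atN !ell1_at_vpos !norm_ell1_at.
Qed.

Lemma ell1_approx x (e : R) : 0 < e ->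
  exists s : {fset I}, `|x| - \sum_(i <- s) `|x i| < e.
Proof.
move=> e0; have finx : (\esum_(i in [set: I]) `|x i|%:E \is a fin_num)%E.
  by rewrite -normell1E.
have [_ [A [finA _] <-]] := ub_ereal_sup_adherent e0 finx.
rewrite -/(esum _ _) -normell1E fsbig_finite// sumEFin -EFinB lte_fin => h.
by exists (fset_set A); lra.
Qed.

(** A coordinate outside all the finite sets [s n], which carry the norm up to [1 / (n + 1)], has
    norm below every such number. *)
Lemma ell1_support x : countable [set i | x i != 0].
Proof.
have /choice[s sP] : forall n, exists s : {fset I},
    `|x| - \sum_(i <- s) `|x i| < n.+1%:R^-1.
  by move=> n; apply: ell1_approx; rewrite invr_gt0.
apply: (@sub_countable _ _ _ (\bigcup_n [set` s n])); last first.
  by apply: bigcup_countable => // n _; exact: countable_fset.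
apply: subset_card_le => i /= xi; apply: contrapT => nsi.
have xi0 : 0 < `|x i| by rewrite normr_gt0.
have [n _ /(_ n (leqnn n)) /= nx] := near_infty_natSinv_lt (PosNum xi0).
have isn : i \notin s n by apply/negP => isn; apply: nsi; exists n.
have := sum_norm_ell1 x (i |` s n)%fset; rewrite big_fsetU1// => h.
have {}h : `|x i| + \sum_(k <- s n) `|x k| <= `|x| := h.
rewrite -lerBrDr in h.
by have := lt_trans nx (le_lt_trans h (sP n)); rewrite ltxx.
Qed.

(** Finite truncations of [x] approximate it. This does for summands what [L1_simple_dense] does for
    measurable sets: identities between bounded functionals are checked one summand at a time. *)
Lemma ell1_functional0 (phi : ell1 I X -> R) (M : R) x : AL_space X ->
  (forall a y z, phi (a *: y + z) = a * phi y + phi z) ->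
  (forall y, `|phi y| <= M * `|y|) ->
  (forall i, phi (ell1_at i (x i)) = 0) -> phi x = 0.
Proof.
move=> AL phi_lin phi_bd phi_at.
have phi00 : phi 0 = 0.
  by have := phi_lin (-1) 0 0; rewrite scaler0 addr0; lra.
apply: (functional_eq0 phi_lin phi_bd) => e e0; have [s xs] := ell1_approx x e0.
pose y := \sum_(i <- s) ell1_at i (x i).
have phiy : phi y = 0.
  rewrite /y; elim/big_ind: _ => // u v u0 v0.
  by rewrite -[u]scale1r phi_lin u0 v0 mulr0 addr0.
have yE k : y k = if k \in s then x k else 0.
  have ev : y k = \sum_(i <- s) ell1_at i (x i) k.
    rewrite /y; elim: (s : seq I) => [|i r ih]; first by rewrite !big_nil.
    by rewrite !big_cons ell1_funD ih.
  rewrite ev; case: ifPn => ks; last first.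
    rewrite big_seq big1// => i si; rewrite ell1_atE; case: eqP => // ki.
    by rewrite ki si in ks.
  rewrite (big_fsetD1 k)// ell1_atE eqxx big_seq big1; first exact: addr0.
  move=> i.
  by rewrite in_fsetD1 ell1_atE eq_sym => /andP[/negbTE->].
(* The truncation and the remainder have disjoint supports, so their absolute values add up to that
   of [x] and the norm is additive. *)
have nx : `|x| = `|y| + `|x - y|.
  rewrite -[in LHS]norm_vabs -(norm_vabs y) -(norm_vabs (x - y)).
  rewrite -(ell1_AL AL); [|exact: vabs_ge0..]; congr `|_|; apply: ell1P => i.
  rewrite ell1_funD !ell1_fun_vabs ell1_funB yE.
  have v0 : vabs (0 : X) = 0 by rewrite vabs_id//; exact: vle_refl.
  by case: ifP => _; rewrite ?subrr ?subr0 v0 ?addr0 ?add0r.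
have ny : \sum_(i <- s) `|x i| <= `|y|.
  apply: le_trans (sum_norm_ell1 y s); rewrite !big_seq; apply: ler_sum => i si.
  by rewrite yE si.
by exists y => //; apply: le_lt_trans xs; lra.
Qed.

Section coordinatewise.
Variable F : I -> X -> X.
Hypothesis F_norm : forall i z, `|F i z| <= `|z|.

Lemma ell1_map_fin x : (\esum_(k in [set: I]) `|F k (x k)|%:E < +oo)%E.
Proof. by apply: le_lt_trans (ell1_finite x); apply: le_esum => i _; rewrite lee_fin. Qed.

Definition ell1_map x : ell1 I X := Ell1 (ell1_map_fin x).

Lemma ell1_mapE x i : ell1_map x i = F i (x i). Proof. by []. Qed.

Lemma ell1_map_lin : (forall i (a : R) z z', F i (a *: z + z') = a *: F i z + F i z') ->
  forall (a : R) x y, ell1_map (a *: x + y) = a *: ell1_map x + ell1_map y.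
Proof.
by move=> Flin a x y; apply: ell1P => i; rewrite ell1_funD ell1_funZ !ell1_mapE -Flin.
Qed.

Lemma norm_ell1_map x : `|ell1_map x| <= `|x|.
Proof.
rewrite -lee_fin !normell1E; apply: le_esum => i _; rewrite lee_fin.
exact: F_norm.
Qed.

Lemma ell1_map_at i z : (forall k, F k 0 = 0) ->
  ell1_map (ell1_at i z) = ell1_at i (F i z).
Proof.
by move=> F0; apply: ell1P => k; rewrite ell1_mapE !ell1_atE; case: eqP => // ->.
Qed.

Lemma band_proj_ell1_map : (forall i, band_proj (F i)) -> band_proj ell1_map.
Proof.
move=> BF; split=> [|x y x' y']; first by apply: ell1_map_lin => i; exact: (BF i).1.
apply: ell1P => i; rewrite ell1_fun_join !ell1_funD !ell1_mapE !ell1_fun_join.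
exact: (BF i).2.
Qed.

End coordinatewise.

End ell1_theory.

Section ell1_cube.
Context (R : realType) (I J : choiceType).

Local Notation Omega := (caratheodory_type (cube_outer_measure R J)).
Local Notation mu := (cube_measure R J).
Local Notation X := (ell1 I (L1 mu)).

Lemma ell1_L1_AL : AL_space X. Proof. by apply: ell1_AL; exact: L1_AL. Qed.

Definition ell1_umul (k : I -> umult Omega R) : X -> X :=
  ell1_map (fun i => @norm_umul _ _ _ mu (k i)).

(** The restriction of [phi] to each summand satisfies the same domination, because [ell1_at i]
    preserves positive parts and norms; the densities found there are assembled by
    [ell1_functional0]. *)
Lemma ell1_functional_density (phi : X -> R) :
  (forall a y z, phi (a *: y + z) = a * phi y + phi z) ->
  (forall y, phi y <= `|vpos y|) ->
  exists k : I -> umult Omega R, forall x, phi x = aint (ell1_umul k x).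
Proof.
move=> phi_lin phi_le.
have phi00 : phi 0 = 0.
  by have := phi_lin (-1) 0 0; rewrite scaler0 addr0; lra.
have phiN x : phi (- x) = - phi x.
  by rewrite -[- x]addr0 -scaleN1r phi_lin phi00; lra.
have phi_bd x : `|phi x| <= `|x|.
  rewrite ler_norml lerNl -phiN -{1}normrN.
  by rewrite !(le_trans (phi_le _))// norm_vpos_le.
have /choice[k kP] : forall i, exists k : umult Omega R, forall z : L1 mu,
    phi (ell1_at i z) = aint (umul k z).
  move=> i; apply: (L1_functional_density (@cube_measure_fin_num R J)).
    by move=> a y z; rewrite ell1_at_lin phi_lin.
  by move=> y; rewrite -(norm_ell1_at i) -ell1_at_vpos.
exists k => x; apply/eqP; rewrite -subr_eq0; apply/eqP.
apply: (@ell1_functional0 _ _ _ (fun y => phi y - aint (ell1_umul k y)) 2).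
- exact: L1_AL.
- apply: sub_aint_lin => //; first exact: ell1_L1_AL.
  by move=> a y z; apply: ell1_map_lin => i; exact: umul_lin.
- move=> y; apply: le_trans (ler_normB _ _) _.
  have := le_trans (norm_aint _) (norm_ell1_map (fun i => @norm_umul _ _ _ mu (k i)) y).
  by have := phi_bd y; rewrite /ell1_umul; lra.
- move=> i; rewrite kP /ell1_umul ell1_map_at; last by move=> l; exact: umul0.
  by rewrite aint_ell1_at subrr.
Qed.

End ell1_cube.

(** * Extending embeddings *)

Lemma countable_range (T : Type) (A : set T) : countable A -> A !=set0 ->
  exists s : nat -> T, (forall n, A (s n)) /\ forall x, A x -> exists n, s n = x.
Proof.
move=> /pfcard_geP[->[]//|[f]] _; exists f; split=> [n|x Ax]; first exact: funS.
by have := @surj _ _ _ _ f => /(_ x Ax)[n _ <-]; exists n.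
Qed.

(** Uncountability of the reals is read off Lebesgue measure: countable sets are null and [0, 1] is
    not. *)
Lemma uncountable_fresh (R : realType) (I : Type) (K : set I) :
  [set: I] #= [set: R] -> countable K -> exists i, ~ K i.
Proof.
move=> IR cK; apply: contrapT => /forallNP allK.
have cI : countable [set: I].
  by apply: sub_countable cK; apply: subset_card_le => i _; apply: contrapT (allK i).
have := countable_lebesgue_measure0 (A := [set: R]).
rewrite -(eq_countable IR) => /(_ cI) R0.
have : (lebesgue_measure (`[0%R, 1%R]%classic : set R) <= 0)%E.
  by rewrite -R0; apply: le_measure; rewrite ?inE.
by rewrite lebesgue_measure_itv /= lte_fin ltr01 oppr0 adde0 lee_fin leNgt ltr01.
Qed.

(** The points [s n] may lie outside [D], so for each [n] and [m] a point of [D] within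
    [1 / (m + 1)] of [s n] is picked when there is one, and [d0] otherwise. *)
Lemma separable_sub (R : realType) (V : normedModType R) (s : nat -> V)
    (D : set V) : (forall x (e : R), 0 < e -> exists n, `|x - s n| < e) -> D !=set0 ->
  exists u : nat -> V, (forall n, D (u n)) /\
    forall x, D x -> forall e : R, 0 < e -> exists n, `|x - u n| < e.
Proof.
move=> s_dense [d0 Dd0].
have /choice[f fP] : forall p : nat * nat, exists y, D y /\
    ((exists2 y', D y' & `|y' - s p.1| < p.2.+1%:R^-1) ->
     `|y - s p.1| < p.2.+1%:R^-1).
  move=> p; have [[y Dy ys]|h] := pselect (exists2 y', D y' & `|y' - s p.1| < p.2.+1%:R^-1).
    by exists y.
  by exists d0.
exists (fun k => oapp f d0 (choice.unpickle k)); split.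
  by move=> n; case: choice.unpickle => [p|//]; exact: (fP p).1.
move=> x Dx e e0; have e2 : 0 < e / 2 by rewrite divr_gt0.
have [m _ /(_ m (leqnn m)) /= me] := near_infty_natSinv_lt (PosNum e2).
have [|n xn] := s_dense x m.+1%:R^-1; first by rewrite invr_gt0.
exists (choice.pickle (n, m)); rewrite choice.pickleK.
have := (fP (n, m)).2 (ex_intro2 _ _ x Dx xn) => /= fn.
rewrite -(subrK (s n) x) -addrA; apply: le_lt_trans (ler_normD _ _) _.
rewrite distrC in fn.
apply: lt_trans (ltrD xn fn) _; rewrite [e]splitr; exact: (ltrD me me).
Qed.

(** * One-step extensions of a graph *)

Section extension_steps.
Context (R : realType) (I J : choiceType) d (T : measurableType d).
Variable nu : {measure set T -> \bar R}.
Hypothesis I_continuum : [set: I] #= [set: R].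
Hypothesis J_continuum : [set: J] #= [set: R].

Local Notation Omega := (caratheodory_type (cube_outer_measure R J)).
Local Notation mu := (cube_measure R J).
Local Notation X := (ell1 I (L1 mu)).
Local Notation V := (L1 nu).

Variable s : nat -> V.
Hypothesis s_dense : forall x (e : R), 0 < e -> exists n, `|x - s n| < e.

(** Density is arranged among the first components, where separability is available; isometry
    carries it over to the second ones. *)
Lemma isograph_dense_seq (G : set (V * X)) : isograph G ->
  exists p : nat -> V * X, (forall n, G (p n)) /\
    forall u, G u -> forall e : R, 0 < e ->
      exists n, `|u.1 - (p n).1| < e /\ `|u.2 - (p n).2| < e.
Proof.
move=> GG; have [|v [Dv v_dense]] := separable_sub (D := fst @` G) s_dense.
  by exists 0, (0, 0) => //; exact: isograph0.
have /choice[p pP] : forall n, exists q, G q /\ q.1 = v n.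
  by move=> n; have [q Gq qv] := Dv n; exists q.
exists p; split=> [n|u Gu e e0]; first exact: (pP n).1.
have [|n un] := v_dense u.1 _ e e0; first by exists u.
exists n; rewrite -(isograph_dist GG Gu (pP n).1) (pP n).2; split=> //.
Qed.

Lemma ell1_umul_lin (k : I -> umult Omega R) (a : R) (x y : X) :
  ell1_umul k (a *: x + y) = a *: ell1_umul k x + ell1_umul k y.
Proof. by apply: ell1_map_lin => i; exact: umul_lin. Qed.

Lemma norm_ell1_umul (k : I -> umult Omega R) (x : X) : `|ell1_umul k x| <= `|x|.
Proof. exact: norm_ell1_map. Qed.

Lemma aint_ell1_umul_bound (k k' : I -> umult Omega R) (y : X) :
  `|aint (ell1_umul k y) - aint (ell1_umul k' y)| <= 2 * `|y|.
Proof.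
by apply: norm_aint_sub; exact: norm_ell1_umul.
Qed.

Lemma aint_ell1_umul_sub_lin (k k' : I -> umult Omega R) (a : R) (y z : X) :
  aint (ell1_umul k (a *: y + z)) - aint (ell1_umul k' (a *: y + z)) =
  a * (aint (ell1_umul k y) - aint (ell1_umul k' y)) +
  (aint (ell1_umul k z) - aint (ell1_umul k' z)).
Proof.
apply: (@sub_aint_lin _ _ _ (fun y => aint (ell1_umul k y)) (ell1_umul k')).
- exact: ell1_L1_AL.
- by apply: AL_aint_comp_lin; [exact: ell1_L1_AL|exact: ell1_umul_lin].
- exact: ell1_umul_lin.
Qed.

Lemma aint_ell1_umul_eq (k k' : I -> umult Omega R) (x : X) :
  (forall i, aint (umul (k i) (x i)) = aint (umul (k' i) (x i))) ->
  aint (ell1_umul k x) = aint (ell1_umul k' x).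
Proof.
move=> kk'; apply/eqP; rewrite -subr_eq0; apply/eqP.
apply: (@ell1_functional0 _ _ _
  (fun y => aint (ell1_umul k y) - aint (ell1_umul k' y)) 2).
- exact: L1_AL.
- exact: aint_ell1_umul_sub_lin.
- exact: aint_ell1_umul_bound.
- move=> i; rewrite /ell1_umul !ell1_map_at; [|by move=> l; exact: umul0..].
  by rewrite !aint_ell1_at kk' subrr.
Qed.

(* Hahn-Banach extends u.2 |-> aint (umul (uind R B) u.1) to all of X, where it
   has a density k with values in [0, 1].  For a coordinate j independent of the
   data, the restriction to the sets where the j-th coordinate is less than k i
   has the same integrals as the multiplication by k. *)
Lemma mult_extension (G : set (V * X)) (B : set T) : isograph G ->
  exists Q : X -> X, band_proj Q /\
    forall u, G u -> aint (umul (uind R B) u.1) = aint (Q u.2).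
Proof.
move=> GG; pose PB : V -> V := umul (uind R B).
(* Passing to the positive part can only increase the integral over [B], and so can dropping [B]. *)
have PB_le x : aint (PB x) <= `|vpos x|.
  have v0 := vpos_ge0 x; rewrite -(aint_ge0E v0).
  apply: le_trans (aint_mono (@L1_AL _ _ _ _) (umul_le (uind R B) v0)).
  apply: aint_mono; first exact: L1_AL.
  apply/vle_sub; rewrite -umulB; apply: umul_ge0.
  by rewrite -(vle_sub x); exact: vle_joinl.
have [|||| L [L_lin L_le LG]] := @hahn_banach _ X (fun x => `|vpos x|)
  [set (u.2, aint (PB u.1)) | u in G].
- by move=> x y; exact: norm_vpos_sub.
- by move=> a x; exact: norm_vposZ.
- move=> a _ _ [u Gu <-] [v Gv <-] /=.
  exists (a *: u.1 + v.1, a *: u.2 + v.2); first exact: isograph_lin.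
  by rewrite /= (AL_aint_comp_lin (@L1_AL _ _ _ _) (umul_lin _)).
(* [G] preserves positive parts and norms, so the bound in [V] becomes domination by the majorant on
   [X]. *)
- move=> _ [u Gu <-] /=; rewrite -(isograph_norm GG (isograph_pos GG Gu)).
  exact: PB_le.
have [k kL] := ell1_functional_density L_lin L_le.
have [p [Gp p_dense]] := isograph_dense_seq GG.
have /choice[K KP] : forall ni : nat * I, exists K : set J, countable K /\
    forall j, ~ K j -> aint (umul (uind R (below_mult j (k ni.2))) ((p ni.1).2 ni.2)) =
      aint (umul (k ni.2) ((p ni.1).2 ni.2)).
  by move=> ni; have [K cK HK] := L1_fresh_mult (k ni.2) ((p ni.1).2 ni.2); exists K.
(* Where [(p n).2 i] is 0 the integrals agree trivially. Countably many pairs [(n, i)] remain, so a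
   single [j] serves all summands. *)
have [|j nKj] := @uncountable_fresh R J
  (\bigcup_n \bigcup_(i in [set i | (p n).2 i != 0]) K (n, i)) J_continuum.
  apply: bigcup_countable => // n _; apply: bigcup_countable => [|i _].
    exact: ell1_support.
  exact: (KP (n, i)).1.
pose A i := uind R (below_mult j (k i)).
exists (ell1_umul A); split.
  by apply: band_proj_ell1_map => i; exact: band_proj_umul.
have eqp n : aint (ell1_umul k (p n).2) = aint (ell1_umul A (p n).2).
  apply: aint_ell1_umul_eq => i.
  have [->|pni] := eqVneq ((p n).2 i) 0; first by rewrite !umul0.
  apply/esym/(KP (n, i)).2 => Kj; apply: nKj; exists n => //; exists i => //.
move=> u Gu; transitivity (L u.2).
  by rewrite (LG (u.2, aint (PB u.1)))//; exists u.
rewrite kL; apply/eqP; rewrite -subr_eq0; apply/eqP.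
apply: (@functional_eq0 _ _ (fun y => aint (ell1_umul k y) - aint (ell1_umul A y)) 2).
- exact: aint_ell1_umul_sub_lin.
- exact: aint_ell1_umul_bound.
- move=> e e0; have [n [_ un]] := p_dense u Gu _ e0.
  by exists (p n).2 => //; rewrite eqp subrr.
Qed.

(** By density all images live on a common countable set of summands, so some summand [i0] carries
    none of them. There [z] is the constant function equal to the norm of [w]; it has that norm
    because the cube has measure 1. *)
Lemma disj_extension (G : set (V * X)) (N : set T) w : isograph G ->
  (forall u, G u -> umul (uind R N) u.1 = 0) -> vle 0 w ->
  umul (uind R N) w = w ->
  exists z : X, isograph [set (u.1 + t *: w, u.2 + t *: z) | u in G & t in [set: R]].
Proof.
move=> GG GN w0 Nw; have [p [Gp p_dense]] := isograph_dense_seq GG.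
have [|i0 ni0] := @uncountable_fresh R I
  (\bigcup_n [set i | (p n).2 i != 0]) I_continuum.
  by apply: bigcup_countable => // n _; exact: ell1_support.
have G0 u : G u -> u.2 i0 = 0.
  move=> Gu; apply/eqP; rewrite -normr_le0; apply/ler_addgt0Pr => e e0; rewrite add0r.
  have [n [_ un]] := p_dense u Gu _ e0.
  have pn0 : (p n).2 i0 = 0.
    by apply/eqP; apply: contrapT => /negP h; apply: ni0; exists n.
  have := norm_coord_ell1 (u.2 - (p n).2) i0; rewrite ell1_funB pn0 subr0.
  by move=> /le_trans; apply; exact: ltW.
pose one := L1_indic (@cube_measure_fin_num R J) setT.
have one1 : `|one| = 1.
  by apply: EFin_inj; rewrite norm_L1_indic// cube_measureT.
(* The projection onto summand [i0], written as a multiplication so that [band_proj_umul] applies in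
   each summand. *)
pose Q : X -> X := ell1_umul (fun i => uind R (if i == i0 then setT else set0)).
pose z : X := ell1_at i0 (`|w| *: one).
have uind0 (x : L1 mu) : umul (uind R set0) x = 0.
  apply: L1_ext; near=> t; rewrite (near (umulE _ _) t)// (near (L1_fun0 mu) t)//.
  by rewrite uindE// indic0 mul0r.
have uindT (x : L1 mu) : umul (uind R setT) x = x.
  apply: L1_ext; near=> t; rewrite (near (umulE _ _) t)//.
  by rewrite uindE// indicT mul1r.
exists z; apply: (@isograph_disj _ _ _ _ (umul (uind R N)) Q) => //.
- exact: L1_AL.
- exact: ell1_L1_AL.
- exact: band_proj_umul.
- by apply: band_proj_ell1_map => i; exact: band_proj_umul.
- move=> u Gu; split; first exact: GN.
  apply: ell1P => i; rewrite ell1_mapE.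
  by case: eqP => [->|_]; rewrite ?uind0// uindT G0.
- move=> i; rewrite ell1_atE; case: eqP => _; last exact: vle_refl.
  by apply: vscale_ge0 => //; exact: L1_indic_ge0.
- apply: ell1P => i; rewrite ell1_mapE ell1_atE.
  by case: eqP => _; rewrite ?uindT// uind0.
- by rewrite norm_ell1_at normrZ one1 mulr1 normr_id.
Unshelve. all: by end_near. Qed.

End extension_steps.

(** * Maximal graphs and extension to the whole space *)

Lemma isograph_bigcup (R : realType) (V X : banachLatticeType R)
    (C : set (set (V * X))) : C !=set0 -> (forall G, C G -> isograph G) ->
  total_on C subset -> isograph (\bigcup_(G in C) G).
Proof.
move=> [G0 CG0] CG Ctot.
have join2 G G' : C G -> C G' -> exists H, [/\ C H, G `<=` H & G' `<=` H].
  by move=> c c'; have [h|h] := Ctot _ _ c c'; [exists G'|exists G]; split.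
split.
- by exists G0 => //; exact: isograph0 (CG _ CG0).
- move=> a u v [G cG Gu] [G' cG' Gv]; have [H [cH GH G'H]] := join2 _ _ cG cG'.
  by exists H => //; apply: (isograph_lin (CG _ cH)); [exact: GH|exact: G'H].
- move=> u v [G cG Gu] [G' cG' Gv]; have [H [cH GH G'H]] := join2 _ _ cG cG'.
  by exists H => //; apply: (isograph_join (CG _ cH)); [exact: GH|exact: G'H].
- by move=> u [G cG Gu]; exact: (isograph_norm (CG _ cG)).
Qed.

Lemma isograph_maximal (R : realType) (V X : banachLatticeType R)
    (G0 : set (V * X)) : isograph G0 ->
  exists G, [/\ isograph G, G0 `<=` G &
    forall H, isograph H -> G `<=` H -> H `<=` G].
Proof.
(* As in [hahn_banach], the empty set accounts for the empty chain. *)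
move=> GG0; pose P (G : set (V * X)) := G = set0 \/ (isograph G /\ G0 `<=` G).
have [|G [PG Gmax]] := @Zorn_bigcup _ P.
  move=> C CP Ctot; pose C' := [set G | C G /\ isograph G /\ G0 `<=` G].
  have CC' : \bigcup_(G in C) G = \bigcup_(G in C') G.
    apply/seteqP; split=> u [G cG Gu]; last by exists G => //; exact: cG.1.
    by have [G00|h] := CP _ cG; [rewrite G00 in Gu|exists G].
  have [[G cG]|noC'] := pselect (C' !=set0).
    right; rewrite CC'; split; last by move=> u /cG.2.2; exists G.
    apply: isograph_bigcup; [by exists G|by move=> H [_ []]|].
    by move=> H H' [cH _] [cH' _]; exact: Ctot.
  left; rewrite CC'; apply/seteqP; split=> // u [G cG _].
  by apply: noC'; exists G.
have [GG G0G] : isograph G /\ G0 `<=` G.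
  case: PG => // Ge; exfalso; apply: (Gmax G0); last by right; split.
  rewrite Ge; split; first by move=> ?.
  by move=> /(_ (0, 0)); apply; exact: isograph0.
exists G; split=> // H HH GH; apply: contrapT => HG.
by apply: (Gmax H); [split|right; split=> //; exact: subset_trans GH].
Qed.

Section total_extension.
Context (R : realType) (I J : choiceType) d (T : measurableType d).
Variable nu : {measure set T -> \bar R}.
Hypothesis I_continuum : [set: I] #= [set: R].
Hypothesis J_continuum : [set: J] #= [set: R].

Local Notation X := (ell1 I (L1 (cube_measure R J))).
Local Notation V := (L1 nu).

Variable s : nat -> V.
Hypothesis s_dense : forall x (e : R), 0 < e -> exists n, `|x - s n| < e.

Lemma isograph_total (G0 : set (V * X)) : isograph G0 ->
  exists G, [/\ isograph G, G0 `<=` G & forall x, exists z, G (x, z)].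
Proof.
move=> GG0; have [G [GG G0G Gmax]] := isograph_maximal GG0.
exists G; split=> //; pose D := fst @` G.
have D_lin (a : R) x y : D x -> D y -> D (a *: x + y).
  by move=> [u Gu <-] [v Gv <-]; exists (a *: u.1 + v.1, a *: u.2 + v.2);
    first exact: isograph_lin.
have D_vabs x : D x -> D (vabs x).
  by move=> [u Gu <-]; exists (vabs u.1, vabs u.2); first exact: isograph_vabs.
have D_closed x : (forall e : R, 0 < e -> exists2 y, D y & `|x - y| <= e) -> D x.
  (* Halving keeps consecutive approximants within [2^-1 ^+ n], so by isometry their images converge
     fast to some [z]. The pair [(x, z)] is in the closure of [G], hence in [G] by maximality. *)
  move=> Dx; have h0 n : 0 < 2^-1 ^+ n / 2 :> R by rewrite divr_gt0// exprn_gt0.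
  have /choice[u uP] : forall n, exists u, G u /\ `|x - u.1| <= 2^-1 ^+ n / 2.
    by move=> n; have [_ [u Gu <-] xu] := Dx _ (h0 n); exists u.
  have ufast n : `|(u n.+1).2 - (u n).2| <= 2^-1 ^+ n.
    rewrite -(isograph_dist GG (uP _).1 (uP _).1).
    have := ler_distD x (u n.+1).1 (u n).1; move/le_trans; apply.
    have := (uP n).2; have := (uP n.+1).2; rewrite exprS distrC.
    by have := h0 n; lra.
  have /cvg_ex[z /cvgrPdist_le uz] := fast_cvg ufast.
  exists (x, z) => //; apply: (Gmax _ (isograph_closureP GG)).
    exact: isograph_closure_sub.
  move=> e e0; have h2 : (fun n => 2^-1 ^+ n / 2 : R) @ \oo --> 0.
    rewrite -[X in _ --> X](mul0r 2^-1); apply: cvgMl; apply: cvg_expr.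
    by rewrite ger0_norm// invf_lt1// ltr1n.
  move/cvgrPdist_le : h2 => /(_ _ e0) h2.
  have [n [un hn]] := filter_ex (filterI (uz _ e0) h2).
  exists (u n); split=> //; first exact: (uP n).1.
  apply: le_trans (uP n).2 _; move: hn; rewrite sub0r normrN; apply: le_trans.
  exact: ler_norm.
have D_uind B x : D x -> D (umul (uind R B) x).
  move=> [u Gu <-].
  have [Q [BQ PQ]] := mult_extension J_continuum s_dense B GG.
  have GG' := isograph_mult (@L1_AL _ _ _ nu) (@ell1_L1_AL _ I J) GG
    (band_proj_umul nu B) BQ PQ.
  exists (umul (uind R B) u.1, Q u.2) => //; apply: (Gmax _ GG').
    exact: isograph_mult_sub.
  exact: (isograph_mult_at GG (band_proj_umul nu B) BQ Gu).
have [p [Gp p_dense]] := isograph_dense_seq s_dense GG.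
have D_ge0 x : vle 0 x -> D x.
  move=> x0; apply: (@L1_support _ _ _ _ D D_lin D_vabs D_closed D_uind _
    (fun n => (p n).1)) => //; first by move=> n; exists (p n).
  (* By density, countably many zero sets are enough to capture the common zero set of the domain,
     which keeps it measurable. *)
  pose N := \bigcap_n (L1_fun (p n).1 @^-1` [set 0]).
  have mN : measurable N.
    apply: bigcap_measurableType => n _; rewrite -[X in measurable X]setTI.
    exact: measurable_L1_fun.
  have GN u : G u -> umul (uind R N) u.1 = 0.
    move=> Gu; apply/eqP; rewrite -normr_le0; apply/ler_addgt0Pr => e e0.
    rewrite add0r; have [n [un _]] := p_dense u Gu e e0.
    have pn0 : umul (uind R N) (p n).1 = 0.
      apply: L1_ext; apply: filterS2 (umulE (uind R N) (p n).1) (L1_fun0 nu).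
      move=> t -> ->; rewrite uindE// indicE.
      case: (boolP (t \in N)) => [|_]; last by rewrite mul0r.
      by rewrite inE => Nt; rewrite (Nt n Logic.I) mulr0.
    rewrite -(subr0 (umul _ u.1)) -pn0 -umulB.
    by apply: le_trans (norm_umul _ _) _; exact: ltW.
  pose w := umul (uind R N) x.
  have [z GG'] := disj_extension I_continuum s_dense GG GN
    (umul_ge0 (uind R N) x0) (uindK N x).
  have Gwz : G (w, z).
    by apply: (Gmax _ GG'); [exact: isograph_disj_sub|exact: isograph_disj_at].
  (* [w] now belongs to the domain, whose elements vanish on [N], while [w] lives on [N]. Hence [x]
     is null on [N], as [L1_support] requires. *)
  have w0 : umul (uind R N) x = 0 by rewrite -uindK; exact: GN Gwz.
  have := umulE (uind R N) x; rewrite w0.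
  apply: filterS2 (L1_fun0 nu) => t -> h pt; move: h.
  by rewrite uindE// indicE mem_set ?mul1r//; move=> n _; exact: pt.
move=> x; suff [u Gu <-] : D x by exists u.2; case: (u) Gu.
rewrite -(vposB x) addrC -scaleN1r.
by apply: D_lin; apply: D_ge0; exact: vpos_ge0.
Qed.

End total_extension.

Lemma embedding_isograph (R : realType) (E V X : banachLatticeType R)
    (f : E -> V) (g : E -> X) : is_embedding f -> is_embedding g ->
  isograph [set (f a, g a) | a in [set: E]].
Proof.
move=> [f_lin f_norm f_join _] [g_lin g_norm g_join _]; split.
- exists 0 => //; congr (_, _).
    by have := f_lin (-1) 0 0; rewrite !scaleN1r !addNr.
  by have := g_lin (-1) 0 0; rewrite !scaleN1r !addNr.
- move=> a _ _ [x _ <-] [y _ <-]; exists (a *: x + y) => //.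
  by rewrite f_lin g_lin.
- move=> _ _ [x _ <-] [y _ <-]; exists (vjoin x y) => //.
  by rewrite f_join g_join.
- by move=> _ [x _ <-] /=; rewrite f_norm g_norm.
Qed.

Theorem theorem5p2 (R : realType) (I J : choiceType)
    (I_continuum : [set: I] #= [set: R]) (J_continuum : [set: J] #= [set: R]) :
  universal_disposition (@separable_L1 R)
    (ell1 I (L1 (cube_measure R J))).
Proof.
move=> E S f g [[A cA dA] [d [T [nu [phi phi_emb phi_surj]]]]] f_emb g_emb.
have phiB a b : phi a - phi b = phi (a - b).
  by rewrite addrC -scaleN1r -(embedding_linear phi_emb) scaleN1r addrC.
have [a0 Aa0] : A !=set0.
  by have [|a [_ Aa]] := dA setT _ openT; [exists 0|exists a].
have [t [At tA]] := countable_range cA (ex_intro _ a0 Aa0).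
have s_dense x (e : R) : 0 < e -> exists n, `|x - phi (t n)| < e.
  move=> e0; have [y <-] := phi_surj x.
  have [|a [ya Aa]] := dA (ball y e) _ (ball_open y e).
    by exists y; exact: ballxx.
  have [n tn] := tA _ Aa; exists n; rewrite phiB (embedding_norm phi_emb) tn.
  by move: ya; rewrite -ball_normE.
have f'_emb : is_embedding (phi \o f).
  have [f1 f2 f3 f4] := f_emb; have [p1 p2 p3 p4] := phi_emb.
  split=> [a x y|x|x y|x y] /=.
  - by rewrite f1 p1.
  - by rewrite p2 f2.
  - by rewrite f3 p3.
  - by rewrite f4 p4.
have [G [GG G0G Gtot]] := isograph_total I_continuum J_continuum s_dense
  (embedding_isograph f'_emb g_emb).
have [h hG] := choice Gtot.
have h_eq x z : G (x, z) -> h x = z by move=> Gz; exact: (isograph_fun GG (hG x) Gz).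
have h_join x y : h (vjoin x y) = vjoin (h x) (h y).
  by apply: h_eq; exact: (isograph_join GG (hG x) (hG y)).
have h_lin (a : R) x y : h (a *: x + y) = a *: h x + h y.
  by apply: h_eq; exact: (isograph_lin GG a (hG x) (hG y)).
have h_opp x : h (- x) = - h x.
  by apply: h_eq; exact: (isographN GG (hG x)).
exists (h \o phi); last first.
  by move=> x /=; apply: h_eq; apply: G0G; exists x.
have [p1 p2 p3 p4] := phi_emb; split=> [a x y|x|x y|x y] /=.
- by rewrite p1 h_lin.
- by rewrite -(isograph_norm GG (hG _)) p2.
- by rewrite p3 h_join.
(* Graphs record joins only; meets are recovered through negation. *)
- by rewrite p4 !vmeetE h_opp h_join !h_opp.
Qed.
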